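(* For every network $\mathbf{G}$ of diameter at most $\Delta$, every first-order formula $\psi$ with $\ell$ free variables, and every finite relation $A$ of arity $\ell$: $\mathbf{G},A\models\psi$ if and only if $\mathbf{G},A\vdash_{FO}\psi$.
   Context: Networks: $U$ is an infinite linearly ordered set of node identifiers. A network $\mathbf{G}=(V,G)$ is a finite, connected, undirected graph with $V\subset U$ and symmetric edge relation $G$, of degree bounded by a constant $D$; $n=|V|$. The model is synchronous message passing. Each node knows its own identifier, its neighbours' identifiers, $n$ and $\Delta$. In each round every node performs local computation and then broadcasts messages to all its neighbours, which receive them. A query is posed by a requesting node. Formulas are first-order over $\{G\}$ with equality and node identifiers as constants. Notation: $\mathbf{G},A\models\psi$ means $A=\{(a_1,\dots,a_\ell)\in V^\ell:\mathbf{G}\models\psi(a_1,\dots,a_\ell)\}$. $\mathbf{G},A\vdash_{FO}\psi$ means that $A$ is the union of all answers produced by the query engine $\mathcal{QE}_{FO}$ on all nodes, upon request of $\psi$ from any node. For a Boolean $\psi$, the answer is the truth value computed by the requesting node. The query engine $\mathcal{QE}_{FO}$ works as follows. - Messages and tables. It uses three kinds of messages: Boolean queries $?B\varphi$ ($\varphi$ a sentence possibly containing constants); partially instantiated queries $?x_1\dots ?x_i\,!a_{i+1}\dots !a_\ell\,\varphi(x_1,\dots,x_i,a_{i+1},\dots,a_\ell)$; and Boolean answers $!B\varphi$ (with a truth value). Each node keeps a query table of pairs (query, parent query) and an answer table. - Local simplification. Every node simplifies each formula it handles by replacing with their truth values all atoms it can decide from its local data. These are the atoms $G(b,c)$ in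 which $b$ or $c$ is its own identifier, and equalities between constants. - Handling a query. The requesting node issues the query. When a node $a$ issues or receives a query that is not yet in its query table, it records the query (with its parent), broadcasts it to its neighbours, and processes it as follows. - If the query still has free variables $x_1,\dots,x_i$, node $a$ instantiates the rightmost one, $x_i$, by its own identifier and handles the resulting subquery in the same way. When all free variables are instantiated (the last one, $x_1$, at node $a_1$), node $a_1$ issues the Boolean query $?B\varphi(a_1,\dots,a_\ell)$ and records it with parent $!a_1\dots!a_\ell\varphi(a_1,\dots,a_\ell)$. - If the query is Boolean of the form $Qx\,\psi$ with $Q\in\{\exists,\forall\}$ the leftmost quantifier, node $a$ instantiates $x$ by its own identifier, obtaining $\psi(a)$. If $\psi(a)$ is true and $Q=\exists$, this is a witness; if $\psi(a)$ is false and $Q=\forall$, this is a counterevidence. If $\psi(a)$ cannot be decided locally, it is recorded with parent $Qx\,\psi$, broadcast, and handled recursively. - Clocks and answers. A node waiting for the answer to a Boolean query sets a clock of $2\Delta w'$ rounds, where $w'$ is the number of variables and constants of that query. If a witness (resp. counterevidence) arrives, $\exists x\psi$ is true (resp. $\forall x\psi$ is false). If none arrives before the clock elapses, $\exists x\psi$ is declared false (resp. $\forall x\psi$ true). Answers are stored and broadcast, each node forwarding a given answer at most once, until they reach the nodes waiting for them; those nodes then evaluate the parent query and store and broadcast its answer. - Storing results. When the Boolean query $?B\varphi(a_1,\dots,a_\ell)$ generated from a fully instantiated query is answered positively, node $a_1$ stores $(a_1,\dots,a_\ell)$ in its answer table.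
   Formalization: The clock's w' counts occurrences of variables and constants, including the variable next to each quantifier (with distinct symbols the claim fails); the requesting node first puts ψ in prenex form; constants of ψ are identifiers of nodes in V. *)

(* Defs.v *)
From HB Require Import structures.
From mathcomp Require Import all_boot all_order.
From mathcomp Require Import finmap.

Set Implicit Arguments.
Unset Strict Implicit.
Unset Printing Implicit Defensive.

Variant quant := qex | qall.

Definition dual q := if q is qex then qall else qex.

(* Variables are de Bruijn indices. In a formula with free variables
   x_1, ..., x_l, the variable x_(i+1) is [Var i] outside all quantifiers. *)
Inductive term (U : Type) := Var of nat | Id of U.
Arguments Var {U}.

Inductive form (U : Type) :=
| Truth of bool
| Edge of term U & term U
| Equal of term U & term U
| Neg of form U
| And of form U & form U
| Or of form U & form U
| Quant of quant & form U.
Arguments Truth {U}.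

(* Unlike eq_comparable, computes. *)
Lemma eqb_comparable (T : eqType) : comparable T.
Proof.
by move=> x y; case E: (x == y); [left; exact/eqP | right=> /eqP; rewrite E].
Defined.

Lemma quant_comparable : comparable quant.
Proof. rewrite /comparable /decidable; decide equality. Defined.
HB.instance Definition _ := hasDecEq.Build quant (compareP quant_comparable).

Lemma term_comparable (U : eqType) : comparable (term U).
Proof.
rewrite /comparable /decidable; decide equality; exact: eqb_comparable.
Defined.
HB.instance Definition _ (U : eqType) :=
  hasDecEq.Build (term U) (compareP (@term_comparable U)).

Lemma form_comparable (U : eqType) : comparable (form U).
Proof.
rewrite /comparable /decidable; decide equality; exact: eqb_comparable.
Defined.
HB.instance Definition _ (U : eqType) :=
  hasDecEq.Build (form U) (compareP (@form_comparable U)).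

Section Syntax.
Variable U : Type.
Implicit Types (t : term U) (f : form U).

Definition term_below k t := if t is Var i then i < k else true.

Fixpoint free_below k f :=
  match f with
  | Truth _ => true
  | Edge s t | Equal s t => term_below k s && term_below k t
  | Neg f => free_below k f
  | And f g | Or f g => free_below k f && free_below k g
  | Quant _ f => free_below k.+1 f
  end.

Definition term_ids t := if t is Id c then [:: c] else [::].

Fixpoint ids f :=
  match f with
  | Truth _ => [::]
  | Edge s t | Equal s t => term_ids s ++ term_ids t
  | Neg f | Quant _ f => ids f
  | And f g | Or f g => ids f ++ ids g
  end.

Definition term_lift c d t :=
  if t is Var i then Var (if i < c then i else i + d) else t.

Fixpoint lift c d f :=
  match f with
  | Truth b => Truth b
  | Edge s t => Edge (term_lift c d s) (term_lift c d t)
  | Equal s t => Equal (term_lift c d s) (term_lift c d t)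
  | Neg f => Neg (lift c d f)
  | And f g => And (lift c d f) (lift c d g)
  | Or f g => Or (lift c d f) (lift c d g)
  | Quant q f => Quant q (lift c.+1 d f)
  end.

Definition term_inst k a t :=
  if t is Var i then
    if i < k then t else if i == k then Id a else Var i.-1
  else t.

Fixpoint inst k (a : U) f :=
  match f with
  | Truth b => Truth b
  | Edge s t => Edge (term_inst k a s) (term_inst k a t)
  | Equal s t => Equal (term_inst k a s) (term_inst k a t)
  | Neg f => Neg (inst k a f)
  | And f g => And (inst k a f) (inst k a g)
  | Or f g => Or (inst k a f) (inst k a g)
  | Quant q f => Quant q (inst k.+1 a f)
  end.

(* Prenex normal form: the quantifier prefix (outermost first) and the
   quantifier-free matrix. *)
Fixpoint pnf f : seq quant * form U :=
  match f with
  | Neg f => let: (p, m) := pnf f in (map dual p, Neg m)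
  | And f g =>
      let: (p, m) := pnf f in let: (p', m') := pnf g in
      (p ++ p', And (lift 0 (size p') m) (lift (size p') (size p) m'))
  | Or f g =>
      let: (p, m) := pnf f in let: (p', m') := pnf g in
      (p ++ p', Or (lift 0 (size p') m) (lift (size p') (size p) m'))
  | Quant q f => let: (p, m) := pnf f in (q :: p, m)
  | _ => ([::], f)
  end.

Definition prenex f := let: (p, m) := pnf f in foldr (@Quant U) m p.

(* The number w' of variables and constants of a formula. Occurrences are
   counted, including the one next to a quantifier: Qx f counts one more than
   each of its instances f(a), so the clock of Qx f outlasts the clocks of its
   instances by 2 Delta, a round trip in the network. *)
Fixpoint nvars_consts f :=
  match f with
  | Truth _ => 0
  | Edge _ _ | Equal _ _ => 2
  | Neg f => nvars_consts f
  | And f g | Or f g => nvars_consts f + nvars_consts g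
  | Quant _ f => (nvars_consts f).+1
  end.

(* Bounds the recursion depth of the local computations. *)
Fixpoint fsize f :=
  match f with
  | Truth _ => 1
  | Edge _ _ | Equal _ _ => 3
  | Neg f | Quant _ f => (fsize f).+1
  | And f g | Or f g => (fsize f + fsize g).+1
  end.

End Syntax.

Record network (U : choiceType) (D : nat) := Network {
  nodes : {fset U};
  edge : rel U;
  nodes_neq0 : nodes != fset0%fset;
  edge_nodes : forall u v, edge u v -> (u \in nodes) && (v \in nodes);
  edge_sym : symmetric edge;
  net_connected : {in nodes &, forall u v,
    exists2 p, path edge u p & last u p = v};
  net_degree : forall u, u \in nodes ->
    #|` [fset v in nodes | edge u v]%fset | <= D }.

Definition diameter_at_most (U : choiceType) D (N : network U D) Delta :=
  {in nodes N &, forall u v,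
    exists p, [/\ path (edge N) u p, last u p = v & size p <= Delta]}.

Section Semantics.
Variables (U : choiceType) (D : nat) (N : network U D).
Implicit Types (rho : nat -> U).

Definition tval rho (t : term U) :=
  match t with Var i => rho i | Id c => c end.

Definition extend (a : U) rho i := if i is j.+1 then rho j else a.

Fixpoint sat rho (f : form U) : Prop :=
  match f with
  | Truth b => b
  | Edge s t => edge N (tval rho s) (tval rho t)
  | Equal s t => tval rho s = tval rho t
  | Neg f => ~ sat rho f
  | And f g => sat rho f /\ sat rho g
  | Or f g => sat rho f \/ sat rho g
  | Quant qex f => exists2 a, a \in nodes N & sat (extend a rho) f
  | Quant qall f => forall a, a \in nodes N -> sat (extend a rho) f
  end.

Definition sat_tuple l (psi : form U) (a : l.-tuple U) :=
  forall rho, (forall i : 'I_l, rho i = tnth a i) -> sat rho psi.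

(* G, A |= psi *)
Definition models l (psi : form U) (A : {fset l.-tuple U}) :=
  forall a : l.-tuple U,
    a \in A <-> {subset a <= nodes N} /\ sat_tuple psi a.

End Semantics.

(* [Ask_bool f] is ?B f and [Ask_inst i [:: a_(i+1); ...; a_l] f] is
   ?x_1 ... ?x_i !a_(i+1) ... !a_l f; for i = 0 the latter only serves as the
   parent of a Boolean query and is never sent. *)
Inductive query (U : Type) :=
| Ask_bool of form U
| Ask_inst of nat & seq U & form U.

Lemma query_comparable (U : eqType) : comparable (query U).
Proof.
rewrite /comparable /decidable; decide equality; exact: eqb_comparable.
Defined.
HB.instance Definition _ (U : eqType) :=
  hasDecEq.Build (query U) (compareP (@query_comparable U)).

Inductive message (U : Type) :=
| Msg_query of query U
| Msg_answer of form U & bool.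

Record local_data (U : Type) := LocalData {
  self : U;
  nbrs : seq U;
  n_nodes : nat;
  diam : nat }.

(* The parent is [None] for a query received from a neighbour and for the
   initial non-Boolean request. *)
Record entry (U : Type) := Entry {
  e_query : query U;
  e_parent : option (query U);
  e_round : nat }.

Record state (U : Type) := State {
  queries : seq (entry U);
  answers : seq (form U * bool);
  results : seq (seq U) }.

Section Engine.
Variable U : eqType.
Implicit Types (f g : form U) (q : query U) (st : state U) (t : nat).
Implicit Types (out : seq (message U)) (p : option (query U)).

Section Node.
Variable ld : local_data U.

Definition simp_edge (s t : term U) : form U :=
  match s, t with
  | Id b, Id c =>
      if b == self ld then Truth (c \in nbrs ld)
      else if c == self ld then Truth (b \in nbrs ld)
      else Edge s t
  | _, _ => Edge s t
  end.

Definition simp_equal (s t : term U) : form U :=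
  match s, t with
  | Id b, Id c => Truth (b == c)
  | _, _ => Equal s t
  end.

Fixpoint simp f : form U :=
  match f with
  | Truth b => Truth b
  | Edge s t => simp_edge s t
  | Equal s t => simp_equal s t
  | Neg f => if simp f is Truth b then Truth (~~ b) else Neg (simp f)
  | And f g =>
      match simp f, simp g with
      | Truth b, g' => if b then g' else Truth false
      | f', Truth b => if b then f' else Truth false
      | f', g' => And f' g'
      end
  | Or f g =>
      match simp f, simp g with
      | Truth b, g' => if b then Truth true else g'
      | f', Truth b => if b then Truth true else f'
      | f', g' => Or f' g'
      end
  | Quant Q f => if simp f is Truth b then Truth b else Quant Q (simp f)
  end.

(* The query that the node generates from [q], with the parent under which it
   is recorded. A quantifier-free Boolean query generates its simplification,
   if this is a different formula. *)
Definition subquery q : option (query U * query U) :=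
  match q with
  | Ask_inst i.+1 s f =>
      let s' := self ld :: s in
      let f' := simp (inst i (self ld) f) in
      if i == 0 then Some (Ask_bool f', Ask_inst 0 s' f')
      else Some (Ask_inst i s' f', q)
  | Ask_inst 0 _ _ => None
  | Ask_bool (Quant _ f) => Some (Ask_bool (simp (inst 0 (self ld) f)), q)
  | Ask_bool f =>
      if simp f == f then None else Some (Ask_bool (simp f), q)
  end.

Definition asked st q := has (fun e => e_query e == q) (queries st).

Definition recorded st q p :=
  has (fun e => (e_query e == q) && (e_parent e == p)) (queries st).

Definition record_query st q p t :=
  State (rcons (queries st) (Entry q p t)) (answers st) (results st).

Definition decided q := if q is Ask_bool (Truth _) then true else false.

Definition broadcast_query q out :=
  if decided q then out else rcons out (Msg_query q).

(* A query already in the table is neither broadcast nor processed again, but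
   a node that issues it under a new parent remembers this parent. *)
Fixpoint handle_rec fuel t (sto : state U * seq (message U)) q p :=
  let: (st, out) := sto in
  if asked st q then
    if (p == None) || recorded st q p then sto
    else (record_query st q p t, out)
  else if fuel is fuel'.+1 then
    let sto' := (record_query st q p t, broadcast_query q out) in
    if subquery q is Some (q', p') then handle_rec fuel' t sto' q' (Some p')
    else sto'
  else sto.

Definition query_depth q :=
  match q with
  | Ask_bool f => (fsize f).+1
  | Ask_inst i _ f => (i + fsize f).+1
  end.

Definition handle t sto (qp : query U * option (query U)) :=
  handle_rec (query_depth qp.1) t sto qp.1 qp.2.

Definition answer_of st f : option bool :=
  if f is Truth b then Some b
  else ohead [seq x.2 | x <- answers st & x.1 == f].

Definition receive_answer (sto : state U * seq (message U)) (fb : form U * bool) :=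
  let: (st, out) := sto in
  if answer_of st fb.1 is Some _ then sto
  else (State (queries st) (rcons (answers st) fb) (results st),
        rcons out (Msg_answer fb.1 fb.2)).

(* The node waits for the answers to the Boolean queries it has issued, i.e.
   those it has recorded with a parent. *)
Definition clock_elapsed st t f :=
  has (fun e => [&& e_query e == Ask_bool f, e_parent e != None
                  & e_round e + 2 * diam ld * nvars_consts f <= t])
      (queries st).

Definition children st f : seq (form U) :=
  pmap (fun e => if e_query e is Ask_bool g then
                   if e_parent e == Some (Ask_bool f) then Some g else None
                 else None)
       (queries st).

(* The truth value of an instance that settles a quantified query: true for a
   witness, false for a counterevidence. *)
Definition evidence Q := if Q is qex then true else false.

Fixpoint evaluate_rec fuel st t f : option bool :=
  if answer_of st f is Some b then Some b
  else if fuel is fuel'.+1 then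
    let vals := pmap (evaluate_rec fuel' st t) (children st f) in
    if f is Quant Q _ then
      if evidence Q \in vals then Some (evidence Q)
      else if clock_elapsed st t f then Some (~~ evidence Q)
      else None
    else ohead vals
  else None.

Definition evaluate st t f := evaluate_rec (fsize f) st t f.

Definition bool_queries st : seq (form U) :=
  undup (pmap (fun e => if e_query e is Ask_bool f then Some f else None)
              (queries st)).

Definition new_answers st t : seq (form U * bool) :=
  pmap (fun f => if answer_of st f is Some _ then None
                 else omap (pair f) (evaluate st t f))
       (bool_queries st).

Definition new_results st : seq (seq U) :=
  pmap (fun e => match e_query e, e_parent e with
                 | Ask_bool f, Some (Ask_inst 0 s _) =>
                     if answer_of st f == Some true then Some s else None
                 | _, _ => None
                 end)
       (queries st).

(* One round of the node: the answers [ans] and queries [qs] at hand are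
   treated before the clocks are consulted. Returns the new state and the
   messages to broadcast. *)
Definition node_round t st (ans : seq (form U * bool))
    (qs : seq (query U * option (query U))) : state U * seq (message U) :=
  let: (st1, out1) := foldl receive_answer (st, [::]) ans in
  let: (st2, out2) := foldl (handle t) (st1, out1) qs in
  let new := new_answers st2 t in
  let st3 := State (queries st2) (answers st2 ++ new) (results st2) in
  (State (queries st3) (answers st3) (undup (results st3 ++ new_results st3)),
   out2 ++ [seq Msg_answer x.1 x.2 | x <- new]).

Definition init_state : state U := State [::] [::] [::].

Definition request_form psi : form U := simp (prenex psi).

Definition request l psi : query U * option (query U) :=
  let f := request_form psi in
  if l == 0 then (Ask_bool f, Some (Ask_inst 0 [::] f))
  else (Ask_inst l [::] f, None).

End Node.

Definition inbox_queries (ms : seq (message U)) :=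
  pmap (fun m => if m is Msg_query q then Some (q, None : option (query U))
                 else None) ms.

Definition inbox_answers (ms : seq (message U)) :=
  pmap (fun m => if m is Msg_answer f b then Some (f, b) else None) ms.

(* State of each node after round [t], and the messages it broadcasts in that
   round; they are received by its neighbours for round [t.+1]. *)
Fixpoint run (lds : U -> local_data U) (r : U) l psi t (a : U) :
    state U * seq (message U) :=
  if t is t'.+1 then
    let inbox := flatten [seq (run lds r l psi t' b).2 | b <- nbrs (lds a)] in
    node_round (lds a) t (run lds r l psi t' a).1
      (inbox_answers inbox) (inbox_queries inbox)
  else
    node_round (lds a) 0 init_state [::]
      (if a == r then [:: request (lds a) l psi] else [::]).

End Engine.

Section Derives.
Variables (U : choiceType) (D : nat) (N : network U D) (Delta : nat).

Definition net_data (a : U) : local_data U :=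
  LocalData a [seq b <- enum_fset (nodes N) | edge N a b]
    #|` nodes N | Delta.

Definition engine_state r l psi t a : state U :=
  (run net_data r l psi t a).1.

Definition computes r psi (b : bool) :=
  exists t, answer_of (engine_state r 0 psi t r)
                      (request_form (net_data r) psi) = Some b.

Definition produced r l psi (s : seq U) :=
  exists t, exists2 a, a \in nodes N & s \in results (engine_state r l psi t a).

(* G, A |-_FO psi *)
Definition derives l (psi : form U) (A : {fset l.-tuple U}) :=
  forall r, r \in nodes N ->
    if l == 0 then
      exists2 b, computes r psi b & forall a : l.-tuple U, (a \in A) = b
    else forall a : l.-tuple U, a \in A <-> produced r l psi a.

End Derives.

(* Main.v *)
(** Prenexing, instantiation by a node and local simplification preserve truth
    in the network, so that every formula handled by a node is equivalent to
    the one it comes from. Every query and every answer is flooded and reaches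
    the whole network within Delta rounds.

    Completeness of the clocks: if a node records a Boolean query [f] with a
    parent in round t0, it has a value for [f] in round t0 + 2 * Delta * w',
    where w' is the number of variables and constants of [f]. For a quantified
    [f] this is the definition of the clock. A quantifier-free [f] reaches
    within Delta rounds a node whose identifier occurs in it; this node
    generates a simplification with a smaller w', and its value for [f] travels
    back within Delta rounds.

    Soundness of the values is by induction on the round, then on the size of
    the formula. The critical case is a clock that elapses without evidence. If
    some node b had evidence, it would have received [f = Qx g] by round
    t0 + Delta, and known the value of its instance [g(b)] 2 * Delta * (w' - 1)
    rounds later by completeness, so its evidence would have arrived Delta
    rounds later, before the clock elapsed. *)

From HB Require Import structures.
From mathcomp Require Import all_boot all_order.
From mathcomp Require Import finmap zify.
Require Import Defs.

Set Implicit Arguments.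
Unset Strict Implicit.
Unset Printing Implicit Defensive.

(** * Formulas *)

Section Formulas.
Variable U : Type.
Implicit Types (s t : term U) (f g m : form U) (p : seq quant).
Implicit Types (a : U) (c d k : nat).

Fixpoint qfree f :=
  match f with
  | Neg f => qfree f
  | And f g | Or f g => qfree f && qfree g
  | Quant _ _ => false
  | _ => true
  end.

Definition quantified f := if f is Quant _ _ then true else false.

Fixpoint prenexed f := if f is Quant _ g then prenexed g else qfree f.

Definition quantify p m := foldr (@Quant U) m p.

Lemma quantifiedP f : reflect (exists Q g, f = Quant Q g) (quantified f).
Proof.
by apply: (iffP idP) => [|[Q [g ->]]//]; case: f => // Q g _; exists Q, g.
Qed.

Lemma qfree_prenexed f : qfree f -> prenexed f.
Proof. by case: f. Qed.

Lemma prenexed_qfree f : ~~ quantified f -> prenexed f = qfree f.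
Proof. by case: f. Qed.

Lemma fsize_gt0 f : 0 < fsize f.
Proof. by case: f. Qed.

Lemma prenexed_quantify p m : qfree m -> prenexed (quantify p m).
Proof. by move=> qm; elim: p => //=; exact: qfree_prenexed. Qed.

Lemma free_below_quantify k p m :
  free_below k (quantify p m) = free_below (size p + k) m.
Proof. by elim: p k => //= Q p IHp k; rewrite IHp addnS addSn. Qed.

Lemma ids_quantify p m : ids (quantify p m) = ids m.
Proof. by elim: p. Qed.

Lemma term_below_lift c d k t :
  term_below k t -> term_below (k + d) (term_lift c d t).
Proof. by case: t => //= i; case: ifP => _; lia. Qed.

Lemma term_ids_lift c d t : term_ids (term_lift c d t) = term_ids t.
Proof. by case: t. Qed.

Lemma term_lift_lift c d t :
  term_lift c d (term_lift c 1 t) = term_lift c d.+1 t.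
Proof.
case: t => //= i; case: (ltnP i c) => [->//|le_ci].
by rewrite ifF; [congr Var|]; lia.
Qed.

Lemma qfree_lift c d f : qfree (lift c d f) = qfree f.
Proof. by elim: f c => //= f IHf g IHg c; rewrite IHf IHg. Qed.

Lemma ids_lift c d f : ids (lift c d f) = ids f.
Proof.
by elim: f c => //= [s t c|s t c|f IHf g IHg c|f IHf g IHg c];
  rewrite ?term_ids_lift ?IHf ?IHg.
Qed.

Lemma free_below_lift c d k f :
  free_below k f -> free_below (k + d) (lift c d f).
Proof.
elim: f c k => //= [s t|s t|f IHf g IHg|f IHf g IHg|_ f IHf] c k.
1-2: by case/andP=> *; rewrite !term_below_lift.
1-2: by case/andP=> *; rewrite IHf ?IHg.
by rewrite -addSn; exact: IHf.
Qed.

Lemma lift_lift c d f : lift c d (lift c 1 f) = lift c d.+1 f.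
Proof.
by elim: f c => //= [s t|s t|f IHf|f IHf g IHg|f IHf g IHg|Q f IHf] c;
  rewrite ?term_lift_lift ?IHf ?IHg.
Qed.

Lemma lift_quantify c d p m :
  lift c d (quantify p m) = quantify p (lift (c + size p) d m).
Proof. by elim: p c => /= [|Q p IHp] c; rewrite ?addn0 // IHp addSnnS. Qed.

Lemma prenexE f : prenex f = quantify (pnf f).1 (pnf f).2.
Proof. by rewrite /prenex; case: (pnf f). Qed.

Lemma qfree_pnf f : qfree (pnf f).2.
Proof.
elim: f => //= [f|f + g|f + g|Q f]; case: (pnf f) => //= p m qm;
  by case: (pnf g) => //= p' m'; rewrite !qfree_lift qm.
Qed.

Lemma ids_pnf f : ids (pnf f).2 = ids f.
Proof.
elim: f => //= [f|f + g|f + g|Q f]; case: (pnf f) => //= p m <-;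
  by case: (pnf g) => //= p' m' <-; rewrite !ids_lift.
Qed.

Lemma free_below_lift_cat k p p' m m' :
  free_below (size p + k) m -> free_below (size p' + k) m' ->
  free_below (size (p ++ p') + k) (lift 0 (size p') m) &&
  free_below (size (p ++ p') + k) (lift (size p') (size p) m').
Proof.
move=> /(free_below_lift 0 (size p')) + /(free_below_lift (size p') (size p)).
by rewrite size_cat !(addnAC _ k) [size p' + size p]addnC => -> ->.
Qed.

Lemma free_below_pnf k f :
  free_below k f -> free_below (size (pnf f).1 + k) (pnf f).2.
Proof.
elim: f k => //= [f IHf|f IHf g IHg|f IHf g IHg|Q f IHf] k.
- by move=> /IHf; case: (pnf f) => p m /=; rewrite size_map.
1-2: case/andP => /IHf + /IHg; case: (pnf f) (pnf g) => p m [p' m'].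
1-2: exact: free_below_lift_cat.
by move=> /IHf; case: (pnf f) => p m /=; rewrite addnS addSn.
Qed.

Lemma prenexed_prenex f : prenexed (prenex f).
Proof. by rewrite prenexE prenexed_quantify ?qfree_pnf. Qed.

Lemma ids_prenex f : ids (prenex f) = ids f.
Proof. by rewrite prenexE ids_quantify ids_pnf. Qed.

Lemma free_below_prenex k f : free_below k f -> free_below k (prenex f).
Proof. by rewrite prenexE free_below_quantify; exact: free_below_pnf. Qed.

Lemma term_below_inst j k a t :
  j <= k -> term_below k.+1 t -> term_below k (term_inst j a t).
Proof. by case: t => //= i le_jk lt_ik; case: ltngtP => //= ?; lia. Qed.

Lemma free_below_inst j k a f :
  j <= k -> free_below k.+1 f -> free_below k (inst j a f).
Proof.
elim: f j k => //= [s t|s t|f IHf g IHg|f IHf g IHg|Q f IHf] j k le_jk.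
1-2: by case/andP=> *; rewrite !term_below_inst.
1-2: by case/andP=> *; rewrite IHf ?IHg.
exact: IHf.
Qed.

Lemma qfree_inst k a f : qfree (inst k a f) = qfree f.
Proof. by elim: f k => //= f IHf g IHg k; rewrite IHf IHg. Qed.

Lemma prenexed_inst k a f : prenexed (inst k a f) = prenexed f.
Proof. by elim: f k => //= *; rewrite !qfree_inst. Qed.

Lemma fsize_inst k a f : fsize (inst k a f) = fsize f.
Proof.
by elim: f k => //= [f IHf|f IHf g IHg|f IHf g IHg|Q f IHf] k;
  rewrite IHf ?IHg.
Qed.

Lemma nvars_consts_inst k a f : nvars_consts (inst k a f) = nvars_consts f.
Proof.
by elim: f k => //= [f IHf g IHg|f IHf g IHg|Q f IHf] k; rewrite IHf ?IHg.
Qed.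

(* The effect of [simp], up to the choice of the truth values. The size
   condition excludes the replacement of one truth value by another. *)
Inductive pruned : form U -> form U -> Prop :=
| pruned_refl f : pruned f f
| pruned_Truth f b of 1 < fsize f : pruned f (Truth b)
| pruned_Neg f f' of pruned f f' : pruned (Neg f) (Neg f')
| pruned_AndL f g f' of pruned f f' : pruned (And f g) f'
| pruned_AndR f g g' of pruned g g' : pruned (And f g) g'
| pruned_And f g f' g' of pruned f f' & pruned g g' :
    pruned (And f g) (And f' g')
| pruned_OrL f g f' of pruned f f' : pruned (Or f g) f'
| pruned_OrR f g g' of pruned g g' : pruned (Or f g) g'
| pruned_Or f g f' g' of pruned f f' & pruned g g' : pruned (Or f g) (Or f' g')
| pruned_Quant Q f f' of pruned f f' : pruned (Quant Q f) (Quant Q f').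

Lemma qfree_pruned f f' : pruned f f' -> qfree f -> qfree f'.
Proof.
elim=> //= [f1 f2 g _ IH|f1 f2 g _ IH|f1 f2 g1 g2 _ IH1 _ IH2
  |f1 f2 g _ IH|f1 f2 g _ IH|f1 f2 g1 g2 _ IH1 _ IH2] /andP[q1 q2].
1,2,4,5: exact: IH.
all: by rewrite IH1 ?IH2.
Qed.

Lemma prenexed_pruned f f' : pruned f f' -> prenexed f -> prenexed f'.
Proof.
elim=> //= [g g'|f1 f2 g _ IH|f1 f2 g _ IH|f1 f2 g1 g2 pr1 _ pr2 _
  |f1 f2 g _ IH|f1 f2 g _ IH|f1 f2 g1 g2 pr1 _ pr2 _].
- by move=> pr _; exact: qfree_pruned.
1,2,4,5: by case/andP=> *; apply: IH; exact: qfree_prenexed.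
all: by case/andP=> *; rewrite (qfree_pruned pr1) ?(qfree_pruned pr2).
Qed.

Lemma free_below_pruned f f' k :
  pruned f f' -> free_below k f -> free_below k f'.
Proof.
move=> pr; elim: pr k => //= [f1 f2 g _ IH|f1 f2 g _ IH|f1 f2 g1 g2 _ IH1 _ IH2
  |f1 f2 g _ IH|f1 f2 g _ IH|f1 f2 g1 g2 _ IH1 _ IH2|Q g g' _ IH] k.
1,2,4,5: by case/andP=> *; exact: IH.
1,2: by case/andP=> *; rewrite IH1 ?IH2.
exact: IH.
Qed.

Lemma nvars_consts_pruned f f' :
  pruned f f' -> nvars_consts f' <= nvars_consts f.
Proof. by elim=> //= *; lia. Qed.

Lemma fsize_pruned f f' : pruned f f' -> f' = f \/ fsize f' < fsize f.
Proof.
elim=> {f f'} /= [f|f b lt1f|f f' _ [->|?]|f g f' _ [->|?]|f g g' _ [->|?]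
  |f g f' g' _ [->|?] _ [->|?]|f g f' _ [->|?]|f g g' _ [->|?]
  |f g f' g' _ [->|?] _ [->|?]|Q f f' _ [->|?]];
  by [left|right; lia].
Qed.
End Formulas.

Lemma ids_pruned (U : eqType) (f f' : form U) :
  pruned f f' -> {subset ids f' <= ids f}.
Proof.
elim=> //= [g x //|f1 f2 g _ IH|f1 f2 g _ IH|f1 f2 g1 g2 _ IH1 _ IH2
  |f1 f2 g _ IH|f1 f2 g _ IH|f1 f2 g1 g2 _ IH1 _ IH2] x;
  rewrite !mem_cat.
1,2,4,5: by move/IH->; rewrite ?orbT.
all: by case/orP=> [/IH1|/IH2] ->; rewrite ?orbT.
Qed.

Lemma term_ids_inst (U : eqType) k (a : U) t :
  {subset term_ids (term_inst k a t) <= a :: term_ids t}.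
Proof.
case: t => [i|c] x /=; last by rewrite (in_cons a) => ->; rewrite orbT.
by case: ifP => // _; case: ifP.
Qed.

Lemma ids_inst (U : eqType) k (a : U) f :
  {subset ids (inst k a f) <= a :: ids f}.
Proof.
have cons_cat (r r' s s' : seq U) : {subset r <= a :: s} ->
    {subset r' <= a :: s'} -> {subset r ++ r' <= a :: s ++ s'}.
  move=> sub_r sub_r' x; rewrite mem_cat inE mem_cat.
  by case/orP=> [/sub_r|/sub_r']; rewrite inE => /orP[]->; rewrite ?orbT.
by elim: f k => //= *; apply: cons_cat => //; exact: term_ids_inst.
Qed.

(** * Local simplification *)

Section Simplification.
Variables (U : eqType) (ld : local_data U).
Implicit Types (f g : form U) (s t : term U) (k : nat).
Local Notation simp := (simp ld).

Lemma simp_Edge s t :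
  (exists b, simp (Edge s t) = Truth b) \/ simp (Edge s t) = Edge s t.
Proof.
by case: s t => [i|b] [j|c] /=; auto; do 2?case: ifP => _; eauto.
Qed.

Lemma simp_Equal s t :
  (exists b, simp (Equal s t) = Truth b) \/ simp (Equal s t) = Equal s t.
Proof. by case: s t => [i|b] [j|c] /=; eauto. Qed.

Lemma simp_Neg f :
  (exists b, simp (Neg f) = Truth b) \/ simp (Neg f) = Neg (simp f).
Proof. by rewrite /=; case: (simp f) => *; [left; eexists|right..]. Qed.

Lemma simp_And f g :
  [\/ simp (And f g) = simp f, simp (And f g) = simp g |
      simp (And f g) = And (simp f) (simp g)].
Proof.
rewrite /=; case: (simp f) => [[]|>|>|>|>|>|>];
  case: (simp g) => [[]|>|>|>|>|>|>];
  first [by constructor 1|by constructor 2|by constructor 3].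
Qed.

Lemma simp_Or f g :
  [\/ simp (Or f g) = simp f, simp (Or f g) = simp g |
      simp (Or f g) = Or (simp f) (simp g)].
Proof.
rewrite /=; case: (simp f) => [[]|>|>|>|>|>|>];
  case: (simp g) => [[]|>|>|>|>|>|>];
  first [by constructor 1|by constructor 2|by constructor 3].
Qed.

Lemma simp_Quant Q f :
  (exists b, simp (Quant Q f) = Truth b) \/
  simp (Quant Q f) = Quant Q (simp f).
Proof. by rewrite /=; case: (simp f) => *; [left; eexists|right..]. Qed.

Lemma pruned_simp f : pruned f (simp f).
Proof.
elim: f => [b|s t|s t|f IHf|f IHf g IHg|f IHf g IHg|Q f IHf].
- exact: pruned_refl.
- by case: (simp_Edge s t) => [[b ->]|->]; constructor.
- by case: (simp_Equal s t) => [[b ->]|->]; constructor.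
- by case: (simp_Neg f) => [[b ->]|->]; constructor; rewrite //= ltnS fsize_gt0.
- by case: (simp_And f g) => ->;
    [exact: pruned_AndL|exact: pruned_AndR|exact: pruned_And].
- by case: (simp_Or f g) => ->;
    [exact: pruned_OrL|exact: pruned_OrR|exact: pruned_Or].
- by case: (simp_Quant Q f) => [[b ->]|->]; constructor;
    rewrite //= ltnS fsize_gt0.
Qed.

Lemma fsize_simp_inst k a f : fsize (simp (inst k a f)) <= fsize f.
Proof.
rewrite -(fsize_inst k a f).
by case: (fsize_pruned (pruned_simp (inst k a f))) => [->|/ltnW].
Qed.

Lemma nvars_consts_simp_self f : qfree f -> free_below 0 f ->
  self ld \in ids f -> nvars_consts (simp f) < nvars_consts f.
Proof.
elim: f => //= [[?|b] [?|c]|[?|b] [?|c]|f IHf|f IHf g IHg|f IHf g IHg] //=.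
- by move=> _ _; rewrite !inE 2![self ld == _]eq_sym => /orP[]/eqP->;
    rewrite eqxx //; case: ifP.
- by move=> qf cf sf; have := IHf qf cf sf; case: (simp f) => //=; lia.
all: move=> /andP[qf qg] /andP[cf cg]; rewrite mem_cat => self_fg.
all: have le_f := nvars_consts_pruned (pruned_simp f).
all: have le_g := nvars_consts_pruned (pruned_simp g).
all: have lt_fg : nvars_consts (simp f) + nvars_consts (simp g) <
       nvars_consts f + nvars_consts g
  by case/orP: self_fg => [/(IHf qf cf)|/(IHg qg cg)]; lia.
- by case: (simp_And f g) => /= -> /=; lia.
- by case: (simp_Or f g) => /= -> /=; lia.
Qed.

Lemma simp_no_ids f : qfree f -> free_below 0 f -> ids f = [::] ->
  exists b, simp f = Truth b.
Proof.
elim: f => //= [b|[?|b] [?|c]|[?|b] [?|c]|f IHf|f IHf g IHg|f IHf g IHg] //=.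
- by exists b.
- by move=> qf cf /(IHf qf cf)[b ->]; exists (~~ b).
all: move=> /andP[qf qg] /andP[cf cg]; case: (ids f) IHf => //= IHf.
all: move=> /(IHg qg cg)[b ->]; have [[] ->] := IHf qf cf erefl.
all: by eexists.
Qed.

(* The formula that a node generates from the Boolean query [f]. *)
Definition reduct f :=
  if f is Quant _ g then simp (inst 0 (self ld) g) else simp f.

Lemma reduct_unquantified f : ~~ quantified f -> reduct f = simp f.
Proof. by case: f. Qed.

Lemma fsize_reduct_Quant Q f : fsize (reduct (Quant Q f)) < fsize (Quant Q f).
Proof. by rewrite /= ltnS fsize_simp_inst. Qed.

Lemma fsize_reduct f : reduct f = f \/ fsize (reduct f) < fsize f.
Proof.
have [/quantifiedP[Q [g ->]]|nq] := boolP (quantified f).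
  by right; exact: fsize_reduct_Quant.
by rewrite reduct_unquantified //; exact: fsize_pruned (pruned_simp f).
Qed.

Lemma nvars_consts_reduct_Quant Q f :
  nvars_consts (reduct (Quant Q f)) < nvars_consts (Quant Q f).
Proof.
rewrite /= ltnS -(nvars_consts_inst 0 (self ld) f).
exact: nvars_consts_pruned (pruned_simp _).
Qed.

Lemma subquery_Ask_bool f :
  subquery ld (Ask_bool f) =
    if reduct f == f then None else Some (Ask_bool (reduct f), Ask_bool f).
Proof.
case: f => // Q f; case: eqP => // eq_f.
by have := fsize_reduct_Quant Q f; rewrite eq_f ltnn.
Qed.
End Simplification.

(** * Truth in the network *)

Section Truth.
Variables (U : choiceType) (D : nat) (N : network U D).
Implicit Types (f g m : form U) (t : term U) (p : seq quant) (a : U).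
Implicit Types (rho : nat -> U) (P : pred U) (Q : quant) (c d k : nat).

Definition quantb Q P :=
  if Q is qex then has P (enum_fset (nodes N)) else all P (enum_fset (nodes N)).

Fixpoint holds rho f : bool :=
  match f with
  | Truth b => b
  | Edge s t => edge N (tval rho s) (tval rho t)
  | Equal s t => tval rho s == tval rho t
  | Neg f => ~~ holds rho f
  | And f g => holds rho f && holds rho g
  | Or f g => holds rho f || holds rho g
  | Quant Q f => quantb Q (fun a => holds (extend a rho) f)
  end.

Lemma holdsP rho f : reflect (sat N rho f) (holds rho f).
Proof.
elim: f rho => [b|s t|s t|f IHf|f IHf g IHg|f IHf g IHg|[] f IHf] rho /=.
- exact: idP.
- exact: idP.
- exact: eqP.
- by apply: (iffP idP) => [/negP nf /IHf|nf]; last by apply/negP => /IHf.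
- by apply: (iffP andP) => -[/IHf ? /IHg ?].
- by apply: (iffP orP) => -[/IHf|/IHg]; auto.
- by apply: (iffP hasP) => -[a aN /IHf]; exists a.
- by apply: (iffP allP) => all_f a /all_f /IHf.
Qed.

Lemma eq_quantb Q P P' : {in nodes N, P =1 P'} -> quantb Q P = quantb Q P'.
Proof. by case: Q => eqP'; [apply: eq_in_has|apply: eq_in_all]. Qed.

Lemma quantb_dual Q P : quantb (dual Q) (fun a => ~~ P a) = ~~ quantb Q P.
Proof. by case: Q; rewrite /quantb /= ?has_predC // -all_predC. Qed.

Lemma quantb_const Q (b : bool) : quantb Q (fun=> b) = b.
Proof.
have /fset0Pn[x xN] := nodes_neq0 N.
case: Q b => -[] //=.
- by apply/hasP; exists x.
- by apply/hasPn.
- by apply/allP.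
- by apply/negbTE/allPn; exists x.
Qed.

Lemma quantb_andb Q P (b : bool) :
  quantb Q (fun a => P a && b) = quantb Q P && b.
Proof.
case: b; first by rewrite andbT; apply: eq_quantb => a; rewrite andbT.
by rewrite andbF -[RHS](quantb_const Q); apply: eq_quantb => a; rewrite andbF.
Qed.

Lemma quantb_orb Q P (b : bool) :
  quantb Q (fun a => P a || b) = quantb Q P || b.
Proof.
case: b; last by rewrite orbF; apply: eq_quantb => a; rewrite orbF.
by rewrite orbT -[RHS](quantb_const Q); apply: eq_quantb => a; rewrite orbT.
Qed.

Lemma quantb_evidence Q P :
  quantb Q P = evidence Q <-> exists2 a, a \in nodes N & P a = evidence Q.
Proof.
case: Q => /=; first by split=> [/hasP|/hasP].
split=> [/negbT/allPn[a aN /negbTE]|[a aN Pa]]; first by exists a.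
by apply/negbTE/allPn; exists a => //; rewrite Pa.
Qed.

Lemma eq_tval_below k rho rho' t : term_below k t ->
  (forall i, i < k -> rho i = rho' i) -> tval rho t = tval rho' t.
Proof. by case: t => //= i lt_ik; exact. Qed.

Lemma eq_holds_below k rho rho' f : free_below k f ->
  (forall i, i < k -> rho i = rho' i) -> holds rho f = holds rho' f.
Proof.
elim: f k rho rho' => //= [s t|s t|f IHf|f IHf g IHg|f IHf g IHg|Q f IHf]
  k rho rho'.
1-2: by case/andP=> *; rewrite !(eq_tval_below (rho' := rho') (k := k)).
- by move=> *; rewrite (IHf k _ rho').
1-2: by case/andP=> *; rewrite (IHf k _ rho') ?(IHg k _ rho').
by move=> cf eq_rho; apply: eq_quantb => a _; apply: (IHf k.+1) => // -[].
Qed.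

Lemma eq_tval rho rho' t : rho =1 rho' -> tval rho t = tval rho' t.
Proof. by case: t => /=. Qed.

Lemma eq_holds rho rho' f : rho =1 rho' -> holds rho f = holds rho' f.
Proof.
elim: f rho rho' => //= [s t|s t|f IHf|f IHf g IHg|f IHf g IHg|Q f IHf]
  rho rho' eq_rho.
1-2: by rewrite !(eq_tval _ eq_rho).
- by rewrite (IHf _ rho').
1-2: by rewrite (IHf _ rho') ?(IHg _ rho').
by apply: eq_quantb => a _; apply: IHf; case.
Qed.

Lemma tval_lift c d rho t :
  tval rho (term_lift c d t) =
  tval (fun i => rho (if i < c then i else i + d)) t.
Proof. by case: t. Qed.

Lemma holds_lift c d rho f :
  holds rho (lift c d f) = holds (fun i => rho (if i < c then i else i + d)) f.
Proof.
elim: f c rho => //= [s t|s t|f IHf|f IHf g IHg|f IHf g IHg|Q f IHf] c rho;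
  rewrite ?tval_lift ?IHf ?IHg //.
apply: eq_quantb => a _; rewrite IHf; apply: eq_holds => -[|i] //=.
by rewrite ltnS; case: ifP.
Qed.

Definition insert k a rho i :=
  if i < k then rho i else if i == k then a else rho i.-1.

Lemma tval_inst k a rho t :
  tval rho (term_inst k a t) = tval (insert k a rho) t.
Proof. by rewrite /insert; case: t => //= i; case: ifP => //; case: ifP. Qed.

Lemma holds_inst k a rho f :
  holds rho (inst k a f) = holds (insert k a rho) f.
Proof.
elim: f k rho => //= [s t|s t|f IHf|f IHf g IHg|f IHf g IHg|Q f IHf] k rho;
  rewrite ?tval_inst ?IHf ?IHg //.
apply: eq_quantb => b _; rewrite IHf; apply: eq_holds => -[|i] //=.
by rewrite /insert ltnS eqSS; case: ltngtP => //; case: i.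
Qed.

Lemma holds_inst0 a rho f : holds rho (inst 0 a f) = holds (extend a rho) f.
Proof. by rewrite holds_inst; apply: eq_holds => -[]. Qed.

Lemma eq_holds_quantify rho p m m' :
  (forall rho', holds rho' m = holds rho' m') ->
  holds rho (quantify p m) = holds rho (quantify p m').
Proof.
by move=> eq_m; elim: p rho => //= Q p IHp rho; apply: eq_quantb => a _.
Qed.

Lemma holds_quantify_Neg rho p m :
  holds rho (quantify (map dual p) (Neg m)) = ~~ holds rho (quantify p m).
Proof.
by elim: p rho => //= Q p IHp rho; rewrite -quantb_dual; apply: eq_quantb.
Qed.

Section Connective.
Variables (con : form U -> form U -> form U) (op : bool -> bool -> bool).
Hypothesis holds_con : forall rho f g,
  holds rho (con f g) = op (holds rho f) (holds rho g).
Hypothesis opC : commutative op.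
Hypothesis quantb_op : forall Q P b,
  quantb Q (fun a => op (P a) b) = op (quantb Q P) b.

Lemma holds_quantify_con_lift rho p m g :
  holds rho (quantify p (con m (lift 0 (size p) g))) =
  op (holds rho (quantify p m)) (holds rho g).
Proof.
elim: p rho g => [|Q p IHp] rho g /=.
  rewrite holds_con holds_lift; congr op.
  by apply: eq_holds => i; rewrite addn0.
rewrite -quantb_op; apply: eq_quantb => a _.
rewrite -lift_lift IHp holds_lift; congr op; apply: eq_holds => i /=.
by rewrite addn1.
Qed.

Lemma holds_quantify_con rho p p' m m' :
  holds rho (quantify (p ++ p')
    (con (lift 0 (size p') m) (lift (size p') (size p) m'))) =
  op (holds rho (quantify p m)) (holds rho (quantify p' m')).
Proof.
rewrite /quantify foldr_cat -holds_quantify_con_lift.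
apply: eq_holds_quantify => rho1.
rewrite holds_con opC lift_quantify add0n -holds_quantify_con_lift.
by apply: eq_holds_quantify => rho2; rewrite !holds_con opC.
Qed.
End Connective.

Lemma holds_prenex rho f : holds rho (prenex f) = holds rho f.
Proof.
rewrite prenexE.
elim: f rho => [b|s t|s t|f IHf|f IHf g IHg|f IHf g IHg|Q f IHf] rho //=.
- by rewrite -IHf; case: (pnf f) => p m; exact: holds_quantify_Neg.
- rewrite -IHf -IHg; case: (pnf f) (pnf g) => p m [p' m'].
  by apply: holds_quantify_con => //; [exact: andbC|exact: quantb_andb].
- rewrite -IHf -IHg; case: (pnf f) (pnf g) => p m [p' m'].
  by apply: holds_quantify_con => //; [exact: orbC|exact: quantb_orb].
- by case: (pnf f) IHf => p m /= IHf; apply: eq_quantb.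
Qed.

Variable Delta : nat.
Local Notation ld := (net_data N Delta).

Lemma mem_nbrs a b : (b \in nbrs (ld a)) = edge N a b.
Proof. by rewrite mem_filter andb_idr // => /edge_nodes/andP[_]; exact. Qed.

Lemma holds_simp rho a f : holds rho (simp (ld a) f) = holds rho f.
Proof.
elim: f rho => [b|s t|s t|f IHf|f IHf g IHg|f IHf g IHg|Q f IHf] rho //.
- case: s t => [i|b] [j|c] //=; case: eqP => [->|_]; first exact: mem_nbrs.
  by case: eqP => [->|//]; rewrite /= edge_sym; exact: mem_nbrs.
- by case: s t => [i|b] [j|c].
- by rewrite [RHS]/= -IHf /=; case: (simp _ f).
- rewrite [RHS]/= -IHf -IHg /=.
  by case: (simp _ f) => [[]|>|>|>|>|>|>];
    case: (simp _ g) => [[]|>|>|>|>|>|>] //=; rewrite ?andbT ?andbF.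
- rewrite [RHS]/= -IHf -IHg /=.
  by case: (simp _ f) => [[]|>|>|>|>|>|>];
    case: (simp _ g) => [[]|>|>|>|>|>|>] //=; rewrite ?orbT ?orbF.
- transitivity (holds rho (Quant Q (simp (ld a) f))).
    by rewrite /=; case: (simp _ f) => //= b; rewrite quantb_const.
  by apply: eq_quantb => b _; exact: IHf.
Qed.

Lemma holds_reduct rho a f :
  ~~ quantified f -> holds rho (reduct (ld a) f) = holds rho f.
Proof. by move=> nq; rewrite reduct_unquantified // holds_simp. Qed.

Lemma holds_reduct_Quant rho a Q f :
  holds rho (reduct (ld a) (Quant Q f)) = holds (extend a rho) f.
Proof. by rewrite holds_simp holds_inst0. Qed.

Definition truth_value f v := forall rho, holds rho f = v.
End Truth.

(** * One round of a node *)

Lemma entry_comparable (U : eqType) : comparable (entry U).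
Proof.
rewrite /comparable /decidable; decide equality; exact: eqb_comparable.
Defined.
HB.instance Definition _ (U : eqType) :=
  hasDecEq.Build (entry U) (compareP (@entry_comparable U)).

Lemma message_comparable (U : eqType) : comparable (message U).
Proof.
rewrite /comparable /decidable; decide equality; exact: eqb_comparable.
Defined.
HB.instance Definition _ (U : eqType) :=
  hasDecEq.Build (message U) (compareP (@message_comparable U)).

Lemma ohead_mem (T : eqType) (s : seq T) x : ohead s = Some x -> x \in s.
Proof. by case: s => //= y s [->]; exact: mem_head. Qed.

Lemma mem_ohead (T : eqType) (s : seq T) x : x \in s -> ohead s.
Proof. by case: s. Qed.

Section Tables.
Variable U : eqType.
Implicit Types (f g : form U) (q : query U) (p : option (query U)).
Implicit Types (st : state U) (t : nat) (b : bool).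

Lemma askedP st q :
  reflect (exists2 e, e \in queries st & e_query e = q) (asked st q).
Proof. by apply: (iffP hasP) => -[e est /eqP]; exists e. Qed.

Lemma recordedP st q p :
  reflect (exists t, Entry q p t \in queries st) (recorded st q p).
Proof.
apply: (iffP hasP) => [[[q' p' t] est /andP[/eqP/= <- /eqP/= <-]]|[t est]].
  by exists t.
by exists (Entry q p t) => //=; rewrite !eqxx.
Qed.

Lemma recorded_asked st q p : recorded st q p -> asked st q.
Proof. by case/recordedP=> t est; apply/askedP; eexists; first exact: est. Qed.

Lemma asked_sub st st' q :
  {subset queries st <= queries st'} -> asked st q -> asked st' q.
Proof. by move=> sub /askedP[e /sub ? ?]; apply/askedP; exists e. Qed.

Lemma recorded_sub st st' q p :
  {subset queries st <= queries st'} -> recorded st q p -> recorded st' q p.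
Proof. by move=> sub /recordedP[t /sub ?]; apply/recordedP; exists t. Qed.

Lemma answer_of_mem st f b :
  answer_of st f = Some b -> f = Truth b \/ (f, b) \in answers st.
Proof.
case: f => [b' [->]|>|>|>|>|>|>]; first by left.
all: move=> /ohead_mem/mapP[[g w]]; rewrite mem_filter.
all: by case/andP=> /eqP/= <- gw ->; right.
Qed.

Lemma mem_answer_of st f b : (f, b) \in answers st -> answer_of st f.
Proof.
have mem_filter_f : (f, b) \in answers st ->
    b \in [seq x.2 | x <- answers st & x.1 == f].
  by move=> fb; apply/mapP; exists (f, b); rewrite // mem_filter eqxx.
by case: f mem_filter_f => // > mem_f /mem_f/mem_ohead.
Qed.

Lemma answered_sub st st' f :
  {subset answers st <= answers st'} -> answer_of st f -> answer_of st' f.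
Proof.
move=> sub; case ans: (answer_of st f) => [b|//] _.
case: (answer_of_mem ans) => [->//|/sub]; exact: mem_answer_of.
Qed.

Lemma mem_children st f g :
  (g \in children st f) = recorded st (Ask_bool g) (Some (Ask_bool f)).
Proof.
rewrite /children /recorded; elim: (queries st) => //= -[q p t] s IHs /=.
case: q => [g'|i r g'] //=; case: (p == _) => /=; rewrite ?andbF //.
by rewrite andbT inE IHs eq_sym; congr (_ || _); apply/eqP/eqP => [->|[]].
Qed.

Lemma mem_bool_queries st f : (f \in bool_queries st) = asked st (Ask_bool f).
Proof.
rewrite mem_undup /asked; elim: (queries st) => //= -[q p t] s IHs /=.
case: q => [g'|i r g'] //=.
by rewrite inE IHs eq_sym; congr (_ || _); apply/eqP/eqP => [->|[]].
Qed.

Lemma mem_inbox_answers (ms : seq (message U)) f b :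
  ((f, b) \in inbox_answers ms) = (Msg_answer f b \in ms).
Proof.
rewrite /inbox_answers; elim: ms => //= -[q|g w] ms IHms //=.
by rewrite !inE IHms; congr (_ || _); apply/eqP/eqP => -[-> ->].
Qed.

Lemma mem_inbox_queries (ms : seq (message U)) q p :
  ((q, p) \in inbox_queries ms) = (p == None) && (Msg_query q \in ms).
Proof.
rewrite /inbox_queries; elim: ms => [|[q'|g w] ms IHms] //=.
  by rewrite andbF.
rewrite !inE IHms; case: p {IHms} => [p|] //=.
  by rewrite !xpair_eqE andbF.
by congr (_ || _); apply/eqP/eqP => -[->].
Qed.

Lemma mem_map_Msg_answer (s : seq (form U * bool)) f b :
  (Msg_answer f b \in [seq Msg_answer fb.1 fb.2 | fb <- s]) = ((f, b) \in s).
Proof.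
have inj : injective (fun fb : form U * bool => Msg_answer fb.1 fb.2).
  by case=> ? ? [? ?] [-> ->].
by rewrite -(mem_map inj).
Qed.

Lemma foldl_receive_answer x (ans : seq (form U * bool)) :
  exists new : seq (form U * bool),
    let y := foldl (@receive_answer U) x ans in
    [/\ y = (State (queries x.1) (answers x.1 ++ new) (results x.1),
             x.2 ++ [seq Msg_answer fb.1 fb.2 | fb <- new]),
        {subset new <= ans} & {in ans, forall fb, answer_of y.1 fb.1}].
Proof.
elim: ans x => [|fb ans IHans] [st out] /=.
  by exists [::]; rewrite !cats0; case: st.
case ans_fb: (answer_of st fb.1) => [b|].
  have [new [eq_y sub_new ans_y]] := IHans (st, out); exists new; split=> //.
    by move=> x /sub_new; rewrite inE orbC => ->.
  move=> x; rewrite inE => /orP[/eqP->|/ans_y //].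
  apply: (answered_sub (st := st)); last by rewrite ans_fb.
  by move=> ? in_st; rewrite eq_y mem_cat in_st.
have [/= new [eq_y sub_new ans_y]] :=
  IHans (State (queries st) (rcons (answers st) fb) (results st),
         rcons out (Msg_answer fb.1 fb.2)).
exists (fb :: new); rewrite /= -!cat_rcons; split=> //.
  by move=> x; rewrite !inE => /orP[->//|/sub_new->]; rewrite orbT.
move=> x; rewrite inE => /orP[/eqP->|/ans_y //].
apply: (mem_answer_of (b := fb.2)); rewrite eq_y mem_cat mem_rcons.
by rewrite -surjective_pairing mem_head.
Qed.
End Tables.

Section HandleQueries.
Variables (U : eqType) (ld : local_data U).
Implicit Types (f g : form U) (q par : query U) (p : option (query U)).
Implicit Types (st : state U) (t : nat) (out : seq (message U)).
Implicit Types (x y z : state U * seq (message U)).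

Lemma subquery_depth q q' par :
  subquery ld q = Some (q', par) -> query_depth q' < query_depth q.
Proof.
case: q => [f|[|i] s f].
- rewrite subquery_Ask_bool; case: eqP => // ne [<- _].
  by case: (fsize_reduct ld f).
- by [].
have le_f := fsize_simp_inst ld i (self ld) f.
by rewrite /=; case: eqP => _ [<- _] /=; lia.
Qed.

Lemma subquery_Ask_bool_parent q q' f :
  subquery ld q = Some (q', Ask_bool f) -> q = Ask_bool f.
Proof.
case: q => [g|[|i] s g] //=; last by case: eqP.
by rewrite -[X in X = _]/(subquery _ (Ask_bool g)) subquery_Ask_bool;
  case: eqP => // _ [_ ->].
Qed.

Definition processed st q := forall q' par,
  subquery ld q = Some (q', par) -> recorded st q' (Some par).

Lemma processed_sub st st' q :
  {subset queries st <= queries st'} -> processed st q -> processed st' q.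
Proof. by move=> sub pq q' par /pq; exact: recorded_sub. Qed.

(* [x] and [y] hold the state of the node and its outgoing messages before and
   after it treats queries in round [t]; [New] is an invariant of the entries
   that it adds to its table. *)
Record handled t (New : query U -> option (query U) -> Prop) x y : Prop := {
  handled_answers : answers y.1 = answers x.1;
  handled_results : results y.1 = results x.1;
  handled_queries : {subset queries x.1 <= queries y.1};
  handled_messages : {subset x.2 <= y.2};
  handled_new_entry : forall e, e \in queries y.1 ->
    e \in queries x.1 \/ e_round e = t /\ New (e_query e) (e_parent e);
  handled_new_message : forall m, m \in y.2 ->
    m \in x.2 \/ exists2 q, m = Msg_query q & asked y.1 q;
  handled_new_query : forall q, asked y.1 q ->
    asked x.1 q \/ processed y.1 q /\ (decided q \/ Msg_query q \in y.2) }.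

Lemma handled_refl t New x : handled t New x x.
Proof. by split=> //; auto. Qed.

Lemma handled_trans t New x y z :
  handled t New x y -> handled t New y z -> handled t New x z.
Proof.
move=> xy yz; split.
- by rewrite (handled_answers yz) (handled_answers xy).
- by rewrite (handled_results yz) (handled_results xy).
- by move=> e /(handled_queries xy)/(handled_queries yz).
- by move=> m /(handled_messages xy)/(handled_messages yz).
- by move=> e /(handled_new_entry yz)[/(handled_new_entry xy)|]; auto.
- move=> m /(handled_new_message yz)[/(handled_new_message xy)[|[q -> aq]]|];
    auto.
  by right; exists q => //; apply: asked_sub (handled_queries yz) aq.
- move=> q /(handled_new_query yz)[/(handled_new_query xy)[|[pq dq]]|]; auto.
  right; split; first exact: processed_sub (handled_queries yz) pq.
  by case: dq => [|/(handled_messages yz)]; auto.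
Qed.

Lemma asked_record st q p t q' :
  asked (record_query st q p t) q' = (q == q') || asked st q'.
Proof. by rewrite /asked has_rcons. Qed.

Lemma recorded_record st q p t : recorded (record_query st q p t) q p.
Proof. by rewrite /recorded has_rcons /= !eqxx. Qed.

Lemma mem_broadcast_query q out m :
  (m \in broadcast_query q out) =
    ~~ decided q && (m == Msg_query q) || (m \in out).
Proof.
by rewrite /broadcast_query; case: ifP => _; rewrite // mem_rcons inE.
Qed.

Lemma handled_record t (New : query U -> option (query U) -> Prop) x q p :
  New q p -> asked x.1 q ->
  handled t New x (record_query x.1 q p t, x.2).
Proof.
move=> New_q aq; split=> //=; auto.
- by move=> e; rewrite mem_rcons inE orbC => ->.
- by move=> e; rewrite mem_rcons inE => /orP[/eqP->|]; auto.
- by move=> q'; rewrite asked_record => /orP[/eqP<-|]; auto.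
Qed.

Lemma handled_issue t (New : query U -> option (query U) -> Prop) x y q p :
  New q p ->
  handled t New (record_query x.1 q p t, broadcast_query q x.2) y ->
  processed y.1 q -> handled t New x y.
Proof.
move=> New_q xy pq.
have aq : asked y.1 q.
  by apply: asked_sub (handled_queries xy) _; rewrite asked_record eqxx.
split; rewrite ?(handled_answers xy) ?(handled_results xy) //.
- move=> e ex; apply: (handled_queries xy).
  by rewrite mem_rcons inE ex orbT.
- move=> m mx; apply: (handled_messages xy).
  by rewrite mem_broadcast_query mx orbT.
- move=> e /(handled_new_entry xy)[|]; auto.
  by rewrite mem_rcons inE => /orP[/eqP->|]; auto.
- move=> m /(handled_new_message xy)[|]; auto.
  rewrite mem_broadcast_query => /orP[/andP[_ /eqP->]|]; auto.
  by right; exists q.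
- move=> q' /(handled_new_query xy)[|]; auto.
  rewrite asked_record => /orP[/eqP<-|]; auto; right; split=> //.
  have [|nd] := boolP (decided q); auto; right; apply: (handled_messages xy).
  by rewrite mem_broadcast_query nd eqxx.
Qed.

Section NewEntries.
Variable New : query U -> option (query U) -> Prop.
Hypothesis New_subquery : forall q p q' par,
  New q p -> subquery ld q = Some (q', par) -> New q' (Some par).

Lemma handle_rec_handled fuel t x q p :
    query_depth q <= fuel -> New q p ->
  let y := handle_rec ld fuel t x q p in
  [/\ handled t New x y, asked y.1 q & p != None -> recorded y.1 q p].
Proof.
elim: fuel x q p => [|fuel IHfuel] [st out] q p /=; first by case: q.
move=> le_q New_q; case: ifPn => [aq|_].
  case: ifPn => [/orP[/eqP->|rq]|_].
  - by split=> //; exact: handled_refl.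
  - by split=> //; exact: handled_refl.
  split; first exact: (@handled_record t New (st, out)).
    by rewrite asked_record eqxx.
  by rewrite recorded_record.
set issued := (record_query st q p t, broadcast_query q out).
have recorded_q y : handled t New issued y -> recorded y.1 q p.
  move/handled_queries/recorded_sub; apply; exact: recorded_record.
case sub_q: (subquery ld q) => [[q' par]|]; last first.
  have xx := handled_refl t New issued.
  split; [|exact: recorded_asked (recorded_q _ xx)|by rewrite recorded_q].
  by apply: (handled_issue (x := (st, out)) New_q xx) => ? ?; rewrite sub_q.
have [||xy _ rq'] := IHfuel issued q' (Some par).
- by rewrite -ltnS (leq_trans (subquery_depth sub_q)).
- exact: New_subquery New_q sub_q.
split; [|exact: recorded_asked (recorded_q _ xy)|by rewrite recorded_q].
apply: (handled_issue (x := (st, out)) New_q xy) => ? ?.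
by rewrite sub_q => -[<- <-]; exact: rq'.
Qed.

Lemma foldl_handle_handled t x (qs : seq (query U * option (query U))) :
    (forall qp, qp \in qs -> New qp.1 qp.2) ->
  let y := foldl (handle ld t) x qs in
  handled t New x y /\
  forall qp, qp \in qs ->
    asked y.1 qp.1 /\ (qp.2 != None -> recorded y.1 qp.1 qp.2).
Proof.
elim: qs x => [|qp qs IHqs] x New_qs /=; first by split; [exact: handled_refl|].
have [|xy aq rq] := @handle_rec_handled (query_depth qp.1) t x _ qp.2 (leqnn _).
  by apply: New_qs; rewrite mem_head.
have [|yz aqs] := IHqs (handle ld t x qp).
  by move=> qp' qp'_qs; apply: New_qs; rewrite inE qp'_qs orbT.
split=> [|qp']; first exact: handled_trans xy yz.
rewrite inE => /orP[/eqP->|/aqs//].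
have sub := handled_queries yz.
by split=> [|/rq]; [exact: asked_sub sub aq|exact: recorded_sub].
Qed.
End NewEntries.
End HandleQueries.

Section NodeRound.
Variables (U : eqType) (ld : local_data U).
Implicit Types (f g : form U) (st : state U) (t : nat) (b : bool).

Lemma new_answersP st t f b :
  reflect [/\ asked st (Ask_bool f), answer_of st f = None &
              evaluate ld st t f = Some b]
          ((f, b) \in new_answers ld st t).
Proof.
rewrite /new_answers mem_pmap; apply: (iffP mapP) => [[g]|[af nf ef]].
  rewrite mem_bool_queries => ag; case ans_g: (answer_of st g) => //.
  by case eval_g: (evaluate _ _ _ _) => //= -[-> ->].
by exists f; rewrite ?mem_bool_queries // nf ef.
Qed.

Lemma node_roundE t st ans qs :
  let y := foldl (handle ld t) (foldl (@receive_answer U) (st, [::]) ans) qs in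
  let new := new_answers ld y.1 t in
  let st' := State (queries y.1) (answers y.1 ++ new) (results y.1) in
  node_round ld t st ans qs =
  (State (queries st') (answers st')
     (undup (results st' ++ new_results st')),
   y.2 ++ [seq Msg_answer fb.1 fb.2 | fb <- new]).
Proof.
rewrite /node_round; case: (foldl _ _ ans) => st1 out1.
by case: (foldl _ _ qs).
Qed.
End NodeRound.

Section Evaluation.
Variables (U : eqType) (ld : local_data U) (st : state U) (t : nat).
Implicit Types (f g : form U) (b : bool).

Hypothesis fsize_children : forall f g,
  g \in children st f -> fsize g < fsize f.

Lemma evaluate_rec_fuel m n f : fsize f <= m -> fsize f <= n ->
  evaluate_rec ld m st t f = evaluate_rec ld n st t f.
Proof.
elim: m n f => [|m IHm] [|n] f le_m le_n; try by have := fsize_gt0 f; lia.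
rewrite /=; case: (answer_of st f) => //.
suff -> : pmap (evaluate_rec ld m st t) (children st f) =
          pmap (evaluate_rec ld n st t) (children st f) by [].
by apply: eq_in_pmap => g /fsize_children lt_g; apply: IHm; lia.
Qed.

Lemma evaluateE f :
  evaluate ld st t f =
  if answer_of st f is Some b then Some b
  else let vals := pmap (evaluate ld st t) (children st f) in
    if f is Quant Q _ then
      if evidence Q \in vals then Some (evidence Q)
      else if clock_elapsed ld st t f then Some (~~ evidence Q)
      else None
    else ohead vals.
Proof.
rewrite {1}/evaluate (evaluate_rec_fuel (leqnn _) (leqnSn _)) /=.
case: (answer_of st f) => //.
suff -> : pmap (evaluate_rec ld (fsize f) st t) (children st f) =
          pmap (evaluate ld st t) (children st f) by [].
apply: eq_in_pmap => g /fsize_children lt_g.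
by apply: evaluate_rec_fuel; rewrite // ltnW.
Qed.
End Evaluation.

(** * Execution on the network *)

Section Execution.
Variables (U : choiceType) (D : nat) (N : network U D) (Delta : nat).
Variables (r : U) (l : nat) (psi : form U).
Implicit Types (f g : form U) (q : query U) (p : option (query U)).
Implicit Types (a b : U) (t : nat) (v : bool).

Local Notation ld := (net_data N Delta).
Local Notation final := (engine_state N Delta r l psi).

Definition sent t a := (run ld r l psi t a).2.

Definition initial t a := if t is t'.+1 then final t' a else @init_state U.

Definition inbox t a : seq (message U) :=
  if t is t'.+1 then flatten [seq sent t' b | b <- nbrs (ld a)] else [::].

Definition requests t a :=
  if t is 0 then if a == r then [:: request (ld a) l psi] else [::]
  else inbox_queries (inbox t a).

Definition answers_stage t a :=
  foldl (@receive_answer U) (initial t a, [::]) (inbox_answers (inbox t a)).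

Definition queries_stage t a :=
  foldl (handle (ld a) t) (answers_stage t a) (requests t a).

(* The state in which the clocks are consulted. *)
Definition clock_state t a := (queries_stage t a).1.

Definition elapsed t a f := clock_elapsed (ld a) (clock_state t a) t f.

Definition value t a f := evaluate (ld a) (clock_state t a) t f.

Lemma runE t a :
  run ld r l psi t a =
  node_round (ld a) t (initial t a) (inbox_answers (inbox t a)) (requests t a).
Proof. by case: t. Qed.

Lemma queries_final t a : queries (final t a) = queries (clock_state t a).
Proof. by rewrite /engine_state runE node_roundE. Qed.

Lemma answers_final t a :
  answers (final t a) =
  answers (clock_state t a) ++ new_answers (ld a) (clock_state t a) t.
Proof. by rewrite /engine_state runE node_roundE. Qed.

Lemma results_final t a :
  results (final t a) =
  undup (results (clock_state t a) ++ new_results (final t a)).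
Proof. by rewrite /engine_state runE node_roundE. Qed.

Lemma sentE t a :
  sent t a = (queries_stage t a).2 ++
    [seq Msg_answer fv.1 fv.2 | fv <- new_answers (ld a) (clock_state t a) t].
Proof. by rewrite /sent runE node_roundE. Qed.

Lemma queries_stageP t a :
  handled (ld a) t (fun _ _ => True) (answers_stage t a) (queries_stage t a) /\
  forall qp, qp \in requests t a -> asked (clock_state t a) qp.1 /\
    (qp.2 != None -> recorded (clock_state t a) qp.1 qp.2).
Proof. exact: foldl_handle_handled. Qed.

Lemma queries_stage_handled t a :
  handled (ld a) t (fun _ _ => True) (answers_stage t a) (queries_stage t a).
Proof. by case: (queries_stageP t a). Qed.

Lemma requests_handled t a qp : qp \in requests t a ->
  asked (clock_state t a) qp.1 /\
  (qp.2 != None -> recorded (clock_state t a) qp.1 qp.2).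
Proof. by case: (queries_stageP t a) => _; apply. Qed.

Lemma answers_stageP t a :
  exists new : seq (form U * bool),
    [/\ answers_stage t a =
          (State (queries (initial t a)) (answers (initial t a) ++ new)
             (results (initial t a)),
           [seq Msg_answer fv.1 fv.2 | fv <- new]),
        forall f v, (f, v) \in new -> Msg_answer f v \in inbox t a &
        forall f v, Msg_answer f v \in inbox t a ->
          answer_of (answers_stage t a).1 f].
Proof.
have [new [eq_stage sub_new answered]] :=
  foldl_receive_answer (initial t a, [::]) (inbox_answers (inbox t a)).
exists new; split=> // f v; rewrite -mem_inbox_answers; first exact: sub_new.
exact: answered.
Qed.

Lemma queries_answers_stage t a :
  queries (answers_stage t a).1 = queries (initial t a).
Proof. by have [new [->]] := answers_stageP t a. Qed.

Lemma results_clock_state t a :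
  results (clock_state t a) = results (initial t a).
Proof.
rewrite /clock_state (handled_results (queries_stage_handled t a)).
by have [new [->]] := answers_stageP t a.
Qed.

Lemma mem_inbox t a m :
  reflect (exists2 b, edge N a b & m \in sent t b) (m \in inbox t.+1 a).
Proof.
apply: (iffP flatten_mapP) => -[b]; first by rewrite mem_nbrs; exists b.
by move=> ab mb; exists b; rewrite ?mem_nbrs.
Qed.

Lemma initial_clock_state_queries t a :
  {subset queries (initial t a) <= queries (clock_state t a)}.
Proof.
rewrite -queries_answers_stage.
exact: handled_queries (queries_stage_handled t a).
Qed.

Lemma initial_clock_state_answers t a :
  {subset answers (initial t a) <= answers (clock_state t a)}.
Proof.
move=> fv; rewrite /clock_state (handled_answers (queries_stage_handled t a)).
have [new [eq_stage _ _]] := answers_stageP t a.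
by rewrite eq_stage mem_cat => ->.
Qed.

Lemma inbox_answered t a f v :
  Msg_answer f v \in inbox t a -> answer_of (clock_state t a) f.
Proof.
have [new [_ _ answered]] := answers_stageP t a.
move=> /answered; apply: answered_sub => x.
by rewrite -(handled_answers (queries_stage_handled t a)).
Qed.

Lemma clock_state_answers t a f v : (f, v) \in answers (clock_state t a) ->
  (f, v) \in answers (initial t a) \/ Msg_answer f v \in inbox t a.
Proof.
rewrite /clock_state (handled_answers (queries_stage_handled t a)).
have [new [-> sub_new _]] := answers_stageP t a.
by rewrite mem_cat => /orP[|/sub_new]; auto.
Qed.

Lemma mem_answers_final t a f v :
  ((f, v) \in answers (final t a)) =
  ((f, v) \in answers (initial t a)) || (Msg_answer f v \in sent t a).
Proof.
have stage := queries_stage_handled t a.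
have [new [eq_stage _ _]] := answers_stageP t a.
rewrite answers_final sentE /clock_state (handled_answers stage).
rewrite eq_stage !mem_cat mem_map_Msg_answer -orbA; congr (_ || _).
congr (_ || _); rewrite -mem_map_Msg_answer; apply/idP/idP => [new_fv|].
  by apply: (handled_messages stage); rewrite eq_stage.
by move=> /(handled_new_message stage)[|[]//]; rewrite eq_stage.
Qed.

Lemma initial_final_le t t' a :
  t < t' -> {subset queries (final t a) <= queries (initial t' a)} /\
            {subset answers (final t a) <= answers (initial t' a)}.
Proof.
elim: t' => // t' IHt'.
rewrite ltnS leq_eqVlt => /orP[/eqP->|/IHt'[subq suba]] /=; first by split.
split=> [e /subq|fv /suba].
  by rewrite queries_final; exact: initial_clock_state_queries.
by rewrite answers_final mem_cat => /initial_clock_state_answers->.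
Qed.

Lemma queries_final_le t t' a :
  t <= t' -> {subset queries (final t a) <= queries (final t' a)}.
Proof. by rewrite -ltnS => /(initial_final_le a)[]. Qed.

Lemma answers_final_clock_state t t' a :
  t < t' -> {subset answers (final t a) <= answers (clock_state t' a)}.
Proof.
by move=> /(initial_final_le a)[_ sub] fv /sub/initial_clock_state_answers.
Qed.

Lemma answers_clock_state_le t t' a :
  t <= t' -> {subset answers (clock_state t a) <= answers (clock_state t' a)}.
Proof.
rewrite leq_eqVlt => /orP[/eqP->//|lt_t] fv in_fv.
by apply: (answers_final_clock_state lt_t); rewrite answers_final mem_cat in_fv.
Qed.

Lemma sent_asked t a q : Msg_query q \in sent t a -> asked (final t a) q.
Proof.
have stage := queries_stage_handled t a.
have [new [eq_stage _ _]] := answers_stageP t a.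
rewrite sentE mem_cat /asked queries_final => /orP[|/mapP[]//].
case/(handled_new_message stage) => [|[q' [->] //]].
by rewrite eq_stage => /mapP[].
Qed.

Lemma final_asked t a q : asked (final t a) q ->
  asked (initial t a) q \/
  processed (ld a) (final t a) q /\ (decided q \/ Msg_query q \in sent t a).
Proof.
rewrite {1}/asked queries_final.
case/(handled_new_query (queries_stage_handled t a)) => [|[pq dq]].
  by rewrite /asked queries_answers_stage; left.
right; split; first by apply: processed_sub pq; rewrite queries_final.
by rewrite sentE mem_cat; case: dq => [|->]; auto.
Qed.

Lemma asked_processed t a q :
  asked (final t a) q -> processed (ld a) (final t a) q.
Proof.
elim: t => [|t IHt] /final_asked[|[]//] //= /IHt.
by apply: processed_sub; exact: queries_final_le.
Qed.

Lemma asked_edge t a b q : edge N a b -> ~~ decided q ->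
  asked (final t a) q -> asked (final t.+1 b) q.
Proof.
move=> ab undecided.
have sent_edge t1 : Msg_query q \in sent t1 a -> asked (final t1.+1 b) q.
  move=> sq; rewrite /asked queries_final.
  have [|//] := @requests_handled t1.+1 b (q, None).
  rewrite mem_inbox_queries eqxx; apply/mem_inbox.
  by exists a; rewrite // edge_sym.
elim: t => [|t IHt] /final_asked[|[_ [/(negP undecided)|/sent_edge]]] //=.
by move=> /IHt; apply: asked_sub; exact: queries_final_le.
Qed.

Lemma answered_edge t a b f : edge N a b ->
  answer_of (final t a) f -> answer_of (clock_state t.+1 b) f.
Proof.
move=> ab; case ans: (answer_of _ f) => [v|//] _.
case: (answer_of_mem ans) => [->//|{ans}].
have sent_edge t1 : Msg_answer f v \in sent t1 a ->
    answer_of (clock_state t1.+1 b) f.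
  move=> sf; apply: (@inbox_answered _ _ f v); apply/mem_inbox.
  by exists a; rewrite // edge_sym.
elim: t => [|t IHt]; rewrite mem_answers_final => /orP[|/sent_edge] //= /IHt.
by apply: answered_sub; exact: answers_clock_state_le.
Qed.

Lemma entry_round_final t a e : e \in queries (final t a) ->
  e_round e <= t /\ e \in queries (final (e_round e) a).
Proof.
have new_entry t1 : e \in queries (final t1 a) ->
    e \in queries (initial t1 a) \/ e_round e = t1.
  rewrite queries_final => /(handled_new_entry (queries_stage_handled t1 a)).
  by rewrite queries_answers_stage => -[|[]]; auto.
elim: t => [|t IHt] e_final; first by case: (new_entry _ e_final) => // ->.
by case: (new_entry _ e_final) => [/IHt[le_t]|->]; rewrite // leqW.
Qed.

Lemma queries_invariant (P : U -> query U -> option (query U) -> Prop) :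
  (forall a q p q' par, P a q p -> subquery (ld a) q = Some (q', par) ->
     P a q' (Some par)) ->
  (forall a b q p, edge N a b -> P a q p -> P b q None) ->
  P r (request (ld r) l psi).1 (request (ld r) l psi).2 ->
  forall t a e, e \in queries (final t a) -> P a (e_query e) (e_parent e).
Proof.
move=> P_subquery P_edge P_request.
have P_round t a : (forall qp, qp \in requests t a -> P a qp.1 qp.2) ->
    (forall e, e \in queries (initial t a) -> P a (e_query e) (e_parent e)) ->
    forall e, e \in queries (final t a) -> P a (e_query e) (e_parent e).
  move=> P_requests P_initial e; rewrite queries_final.
  have [/handled_new_entry new_entry _] := @foldl_handle_handled _ (ld a) (P a)
    (P_subquery a) t (answers_stage t a) (requests t a) P_requests.
  by case/new_entry=> [|[]//]; rewrite queries_answers_stage; exact: P_initial.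
elim=> [|t IHt] a; apply: P_round => //=; last exact: IHt.
  by move=> qp; case: eqP => // ->; rewrite inE => /eqP->.
case=> q p; rewrite mem_inbox_queries => /andP[/eqP->].
case/mem_inbox=> b ab /sent_asked/askedP[e /IHt Pe <-].
by apply: P_edge Pe; rewrite edge_sym.
Qed.

Lemma Ask_bool_parent t a e f :
  e \in queries (final t a) -> e_parent e = Some (Ask_bool f) ->
  subquery (ld a) (Ask_bool f) = Some (e_query e, Ask_bool f).
Proof.
move=> e_final; move: f; pose generated a q p := forall f : form U,
  p = Some (Ask_bool f) -> subquery (ld a) (Ask_bool f) = Some (q, Ask_bool f).
apply: (queries_invariant (P := generated)) e_final => //.
  move=> b q p q' par _ sub_q f [eq_par]; rewrite eq_par in sub_q *.
  by rewrite -{1}(subquery_Ask_bool_parent sub_q).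
by rewrite /generated /request; case: eqP.
Qed.

Lemma child_reduct t a f g : g \in children (clock_state t a) f ->
  reduct (ld a) f <> f /\ g = reduct (ld a) f.
Proof.
rewrite mem_children /recorded -queries_final => /recordedP[t0].
move=> /Ask_bool_parent/(_ erefl); rewrite subquery_Ask_bool.
by case: eqP => // ? [<-].
Qed.

Lemma fsize_children t a f g :
  g \in children (clock_state t a) f -> fsize g < fsize f.
Proof. by case/child_reduct=> neq_f ->; case: (fsize_reduct (ld a) f). Qed.

Lemma valueE t a f :
  value t a f =
  if answer_of (clock_state t a) f is Some v then Some v
  else let vals := pmap (value t a) (children (clock_state t a) f) in
    if f is Quant Q _ then
      if evidence Q \in vals then Some (evidence Q)
      else if elapsed t a f then Some (~~ evidence Q) else None
    else ohead vals.
Proof. by rewrite /value (evaluateE _ _ (@fsize_children t a)). Qed.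

Lemma mem_children_values t a f v :
  reflect (exists2 g, g \in children (clock_state t a) f & value t a g = Some v)
          (v \in pmap (value t a) (children (clock_state t a) f)).
Proof. by rewrite mem_pmap; apply: (iffP mapP) => -[g]; exists g. Qed.

Variant value_spec t a f v : Prop :=
| Value_answer of answer_of (clock_state t a) f = Some v
| Value_child g of ~~ quantified f & g \in children (clock_state t a) f &
    value t a g = Some v
| Value_evidence Q h g of f = Quant Q h & v = evidence Q &
    g \in children (clock_state t a) f & value t a g = Some v
| Value_elapsed Q h of f = Quant Q h & v = ~~ evidence Q &
    answer_of (clock_state t a) f = None & elapsed t a f &
    (forall g, g \in children (clock_state t a) f ->
       value t a g <> Some (evidence Q)).

Lemma valueP t a f v : value t a f = Some v -> value_spec t a f v.
Proof.
rewrite valueE; case ans: (answer_of _ f) => [w|].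
  by case=> <-; exact: Value_answer.
have [/quantifiedP[Q [h eq_f]]|nq] := boolP (quantified f); last first.
  move=> value_f; have /ohead_mem/mem_children_values[g] :
      ohead (pmap (value t a) (children (clock_state t a) f)) = Some v.
    by case: (f) nq value_f.
  exact: Value_child.
rewrite eq_f in ans * => /=.
case: ifP => [/mem_children_values[g gf value_g]|no_evidence].
  by case=> <-; exact: Value_evidence gf value_g.
case: ifP => // clock [<-].
apply: Value_elapsed ans clock _ => // g gf value_g.
by case/mem_children_values: no_evidence; exists g.
Qed.

Lemma answered_value t a f : answer_of (clock_state t a) f -> value t a f.
Proof. by rewrite valueE; case: (answer_of _ f). Qed.

Lemma child_value t a f g :
  ~~ quantified f -> g \in children (clock_state t a) f ->
  value t a g -> value t a f.
Proof.
move=> nq gf; case value_g: (value t a g) => [v|//] _.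
rewrite valueE; case: (answer_of _ f) => //.
have /mem_ohead : v \in pmap (value t a) (children (clock_state t a) f).
  by apply/mem_children_values; exists g.
by case: f nq {gf}.
Qed.

Lemma evidence_value t a Q h g :
  g \in children (clock_state t a) (Quant Q h) ->
  value t a g = Some (evidence Q) -> value t a (Quant Q h).
Proof.
move=> gf value_g; rewrite valueE; case: (answer_of _ _) => //=.
by case: mem_children_values => // -[]; exists g.
Qed.

Lemma elapsed_Quant_value t a Q h :
  elapsed t a (Quant Q h) -> value t a (Quant Q h).
Proof.
move=> clock; rewrite valueE; case: (answer_of _ _) => //=.
by rewrite clock; case: ifP.
Qed.

Lemma value_answered t a f : asked (final t a) (Ask_bool f) ->
  value t a f -> answer_of (final t a) f.
Proof.
move=> af; case val: (value t a f) => [v|//] _.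
case ans: (answer_of (clock_state t a) f) => [w|].
  apply: (answered_sub (st := clock_state t a)); last by rewrite ans.
  by move=> x in_x; rewrite answers_final mem_cat in_x.
apply: (mem_answer_of (b := v)); rewrite answers_final mem_cat.
apply/orP; right; apply/new_answersP; split=> //.
by move: af; rewrite /asked queries_final.
Qed.

Lemma clock_state_answers_final t a f v : a \in nodes N ->
  (f, v) \in answers (clock_state t a) ->
  exists t' b, [/\ t' < t, b \in nodes N & (f, v) \in answers (final t' b)].
Proof.
case: t => [|t] aN /clock_state_answers[] //.
  by move=> fv; exists t, a.
case/mem_inbox=> b /edge_nodes/andP[_ bN] sent_fv; exists t, b.
by rewrite mem_answers_final sent_fv orbT.
Qed.

Lemma answers_origin t a f v : a \in nodes N ->
  (f, v) \in answers (final t a) ->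
  exists t' b, [/\ t' <= t, b \in nodes N & value t' b f = Some v].
Proof.
elim/ltn_ind: t a => t IHt a aN; rewrite answers_final mem_cat => /orP[].
  case/(clock_state_answers_final aN) => t' [b [lt_t bN]].
  case/(IHt _ lt_t _ bN) => t'' [c [le_t' cN val]]; exists t'', c.
  by split=> //; lia.
by case/new_answersP=> _ _ val; exists t, a.
Qed.

Lemma elapsed_asked t a f : elapsed t a f ->
  exists2 t0, asked (final t0 a) (Ask_bool f) &
              t0 + 2 * Delta * nvars_consts f <= t.
Proof.
case/hasP=> e; rewrite -queries_final => /entry_round_final[_ e_final].
case/and3P=> /eqP eq_f _ le_t; exists (e_round e) => //.
by apply/askedP; exists e.
Qed.

Lemma recorded_elapsed t0 t a f (q : query U) :
  recorded (final t0 a) (Ask_bool f) (Some q) ->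
  t0 + 2 * Delta * nvars_consts f <= t -> elapsed t a f.
Proof.
case/recordedP=> t1 e_final le_t.
have [/= le_t1 _] := entry_round_final e_final.
apply/hasP; exists (Entry (Ask_bool f) (Some q) t1).
  by rewrite -queries_final; apply: queries_final_le e_final; lia.
by rewrite /= eqxx /=; lia.
Qed.

Lemma reduct_elapsed t0 t a f :
  asked (final t0 a) (Ask_bool f) -> reduct (ld a) f <> f ->
  t0 + 2 * Delta * nvars_consts (reduct (ld a) f) <= t ->
  reduct (ld a) f \in children (clock_state t a) f /\
  elapsed t a (reduct (ld a) f).
Proof.
move=> af /eqP/negPf neq_f le_t.
have rec_g :
    recorded (final t0 a) (Ask_bool (reduct (ld a) f)) (Some (Ask_bool f)).
  by apply: (asked_processed af); rewrite subquery_Ask_bool neq_f.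
split; last exact: recorded_elapsed rec_g le_t.
rewrite mem_children /recorded -queries_final.
by apply: recorded_sub rec_g; apply: queries_final_le; lia.
Qed.

(** * Flooding *)

Lemma path_propagates (P : nat -> U -> Prop) :
  (forall t a b, edge N a b -> P t a -> P t.+1 b) ->
  forall t a s, path (edge N) a s -> P t a -> P (t + size s) (last a s).
Proof.
move=> P_edge t a s; elim: s t a => [|b s IHs] t a /=; first by rewrite addn0.
case/andP=> ab path_s Pa; rewrite -addSnnS.
exact: IHs path_s (P_edge _ _ _ ab Pa).
Qed.

Hypothesis N_diameter : diameter_at_most N Delta.

Lemma asked_everywhere t a b q : a \in nodes N -> b \in nodes N ->
  ~~ decided q -> asked (final t a) q -> asked (final (t + Delta) b) q.
Proof.
move=> aN bN undecided aq; have [s [path_s <- le_s]] := N_diameter aN bN.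
apply: (@asked_sub _ (final (t + size s) (last a s))).
  by apply: queries_final_le; rewrite leq_add2l.
apply: (path_propagates (P := fun t a => asked (final t a) q)) path_s aq.
by move=> t1 c d cd; exact: asked_edge.
Qed.

Lemma answered_everywhere t t' a b f : a \in nodes N -> b \in nodes N ->
  t < t' -> t + Delta <= t' ->
  answer_of (final t a) f -> answer_of (clock_state t' b) f.
Proof.
move=> aN bN lt_t le_t' af.
have [[|c s] [/= path_s last_s le_s]] := N_diameter aN bN.
  by rewrite -last_s; apply: answered_sub af; exact: answers_final_clock_state.
move: path_s; rewrite -last_s => /andP[ac path_s].
apply: (answered_sub (st := clock_state (t.+1 + size s) (last c s))).
  by apply: answers_clock_state_le; lia.
pose answered t a : Prop := answer_of (clock_state t a) f.
apply: (path_propagates (P := answered)) path_s _.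
  move=> t1 d e de ans; apply: answered_edge de _; apply: answered_sub ans => x.
  by rewrite answers_final mem_cat => ->.
exact: answered_edge af.
Qed.

Lemma diameter0_eq a b :
  a \in nodes N -> b \in nodes N -> Delta = 0 -> a = b.
Proof.
move=> aN bN Delta0; have [s [_ <-]] := N_diameter aN bN.
by rewrite Delta0 leqn0 => /nilP->.
Qed.

Lemma value_everywhere t t' a b f : a \in nodes N -> b \in nodes N ->
  asked (final t a) (Ask_bool f) -> value t a f -> t + Delta <= t' ->
  value t' b f.
Proof.
move=> aN bN af val le_t'; have [lt_t|ge_t] := ltnP t t'.
  apply: answered_value.
  exact: answered_everywhere aN bN lt_t le_t' (value_answered af val).
have -> : t' = t by lia.
by have <- : a = b by apply: diameter0_eq => //; lia.
Qed.

(* The round trip of a Boolean query that node [b] reduces: the reduct has a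
   smaller clock, which leaves Delta rounds for the query to reach [b] and
   Delta rounds for the answer to return. *)
Lemma reduct_elapsed_everywhere t0 t a b f : a \in nodes N -> b \in nodes N ->
  asked (final t0 a) (Ask_bool f) ->
  nvars_consts (reduct (ld b) f) < nvars_consts f ->
  t0 + 2 * Delta * nvars_consts f <= t ->
  exists2 tb, tb + Delta <= t &
    [/\ asked (final tb b) (Ask_bool f),
        reduct (ld b) f \in children (clock_state tb b) f &
        elapsed tb b (reduct (ld b) f)].
Proof.
move=> aN bN af lt_f le_t.
have undecided : ~~ decided (Ask_bool f) by case: (f) lt_f.
have bf := asked_everywhere aN bN undecided af.
exists (t0 + Delta + 2 * Delta * nvars_consts (reduct (ld b) f)); first by nia.
have [|gf clock_g] := reduct_elapsed bf _ (leqnn _).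
  by move=> eq_f; rewrite eq_f ltnn in lt_f.
by split=> //; apply: asked_sub bf; apply: queries_final_le; rewrite leq_addr.
Qed.
End Execution.

(** * Correctness of the engine *)

Section Correctness.
Variables (U : choiceType) (D : nat) (N : network U D) (Delta : nat).
Variables (r : U) (l : nat) (psi : form U).
Hypothesis N_diameter : diameter_at_most N Delta.
Hypothesis rN : r \in nodes N.
Hypothesis psi_free : free_below l psi.
Hypothesis psi_ids : {subset ids psi <= nodes N}.
Implicit Types (f g : form U) (q : query U) (p : option (query U)).
Implicit Types (a b : U) (s : seq U) (t : nat) (v : bool).

Local Notation ld := (net_data N Delta).
Local Notation final := (engine_state N Delta r l psi).
Local Notation clock_state := (clock_state N Delta r l psi).
Local Notation value := (value N Delta r l psi).
Local Notation elapsed := (elapsed N Delta r l psi).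
Local Notation initial_request := (request (ld r) l psi).
Local Notation initial_form := (request_form (ld r) psi).

(* The values of x_1, ..., x_l when x_(i+1), ..., x_l are instantiated by [s]
   and the others are given by [rho]. *)
Definition instantiate i s (rho : nat -> U) j :=
  if j < i then rho j else nth (rho j) s (j - i).

Definition wf_form k f :=
  [/\ free_below k f, prenexed f & {subset ids f <= nodes N}].

Definition wf_query q : Prop :=
  match q with
  | Ask_bool f => wf_form 0 f
  | Ask_inst i s f =>
      [/\ i + size s = l, {subset s <= nodes N}, wf_form i f &
          forall rho, holds N rho f = holds N (instantiate i s rho) psi]
  end.

Definition wf_entry a q p : Prop :=
  [/\ a \in nodes N, wf_query q &
      forall s f, p = Some (Ask_inst 0 s f) ->
        q = Ask_bool f /\ wf_query (Ask_inst 0 s f)].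

Lemma wf_simp k a f : wf_form k f -> wf_form k (simp (ld a) f).
Proof.
have pr := pruned_simp (ld a) f.
case=> cf pf idsf; split; first exact: free_below_pruned pr cf.
  exact: prenexed_pruned pr pf.
by move=> x /(ids_pruned pr)/idsf.
Qed.

Lemma wf_inst k a f : a \in nodes N -> wf_form k.+1 f -> wf_form k (inst k a f).
Proof.
move=> aN [cf pf idsf]; split; first exact: free_below_inst.
  by rewrite prenexed_inst.
by move=> x /ids_inst; rewrite inE => /orP[/eqP->//|/idsf].
Qed.

Lemma wf_reduct a f : a \in nodes N -> wf_form 0 f ->
  wf_form 0 (reduct (ld a) f).
Proof.
move=> aN; have [/quantifiedP[Q [g ->]]|nq] := boolP (quantified f).
  by case=> cg pg idsg; apply/wf_simp/wf_inst.
by rewrite reduct_unquantified //; exact: wf_simp.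
Qed.

Lemma wf_instance a i s f : a \in nodes N -> wf_query (Ask_inst i.+1 s f) ->
  wf_query (Ask_inst i (a :: s) (simp (ld a) (inst i a f))).
Proof.
move=> aN [eq_l sN wf_f holds_f]; split=> /=.
- by rewrite -eq_l addSnnS.
- by move=> x; rewrite inE => /orP[/eqP->//|/sN].
- exact/wf_simp/wf_inst.
move=> rho; rewrite holds_simp holds_inst holds_f.
apply: (eq_holds_below _ psi_free) => j lt_jl.
rewrite /instantiate /insert ltnS; case: (ltngtP j i) => ji //=.
- rewrite (_ : j - i = (j - i.+1).+1); last by lia.
  by rewrite /=; apply: set_nth_default; lia.
- by rewrite ji subnn.
Qed.

Lemma wf_subquery a q p q' par : wf_entry a q p ->
  subquery (ld a) q = Some (q', par) -> wf_entry a q' (Some par).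
Proof.
case=> aN wf_q _; case: q wf_q => [f|[|i] s f] wf_q //.
  rewrite subquery_Ask_bool; case: eqP => // _ [<- <-].
  by split=> //; exact: wf_reduct.
have wf_i := wf_instance aN wf_q.
rewrite /=; case: eqP => [i0|_] [<- <-]; split=> //; last first.
- by move=> s' f' [<- <-]; split; rewrite // -?i0.
- by case: wf_i; rewrite i0.
Qed.

Lemma wf_request_form : wf_form l initial_form.
Proof.
apply: wf_simp; split; first exact: free_below_prenex.
  exact: prenexed_prenex.
by rewrite ids_prenex.
Qed.

Lemma holds_request_form rho : holds N rho initial_form = holds N rho psi.
Proof. by rewrite holds_simp holds_prenex. Qed.

Lemma wf_request : wf_entry r initial_request.1 initial_request.2.
Proof.
have wf_l : wf_query (Ask_inst l [::] initial_form).
  split=> //; [exact: addn0|exact: wf_request_form|move=> rho].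
  rewrite holds_request_form; apply: (eq_holds_below _ psi_free) => i lt_il.
  by rewrite /instantiate lt_il.
rewrite /request; case: eqP wf_l => [-> wf_0|_ wf_l]; split=> //=.
  by case: wf_0.
by move=> s f [<- <-].
Qed.

Lemma wf_queries t a e : e \in queries (final t a) ->
  wf_entry a (e_query e) (e_parent e).
Proof.
apply: (queries_invariant (P := wf_entry)) => [b q p q' par||].
- exact: wf_subquery.
- by move=> b c q p /edge_nodes/andP[_ cN] [_ wf_q _]; split.
- exact: wf_request.
Qed.

Lemma wf_asked t a f : asked (final t a) (Ask_bool f) -> wf_form 0 f.
Proof. by case/askedP=> e /wf_queries[_ + _] eq_f; rewrite eq_f. Qed.

Lemma some_node_simplifies a f : a \in nodes N -> wf_form 0 f -> qfree f ->
  (exists v, simp (ld a) f = Truth v) \/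
  exists2 b, b \in nodes N & nvars_consts (simp (ld b) f) < nvars_consts f.
Proof.
move=> aN [cf _ idsf] qf; case ids_f: (ids f) => [|b s].
  by left; exact: simp_no_ids.
have b_ids : b \in ids f by rewrite ids_f mem_head.
by right; exists b; [exact: idsf|exact: nvars_consts_simp_self].
Qed.

Lemma elapsed_value t a f : a \in nodes N -> elapsed t a f -> value t a f.
Proof.
have [n] := ubnP (fsize f); elim: n t a f => // n IHn t a f.
rewrite ltnS => le_f aN clock.
have [/quantifiedP[Q [h eq_f]]|nq] := boolP (quantified f).
  by rewrite eq_f in clock *; exact: elapsed_Quant_value.
case ans: (answer_of (clock_state t a) f) => [v|].
  by apply: answered_value; rewrite ans.
have [t0 af le_t] := elapsed_asked clock.
have wf_f := wf_asked af; have [_ pf _] := wf_f.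
rewrite prenexed_qfree // in pf.
have reductE b := reduct_unquantified (ld b) nq.
case: (some_node_simplifies aN wf_f pf) => [[v]|[b bN]]; rewrite -reductE.
  move=> eq_v; have [||gf _] := @reduct_elapsed _ _ N Delta r l psi t0 t a f af.
  - by rewrite eq_v => eq_f; rewrite -eq_f in ans.
  - by rewrite eq_v /= muln0 addn0; lia.
  by apply: (child_value nq gf); rewrite eq_v.
move=> lt_f.
have [tb le_tb [bf gf clock_g]] :=
  reduct_elapsed_everywhere N_diameter aN bN af lt_f le_t.
apply: (value_everywhere N_diameter bN aN bf _ le_tb).
apply: (child_value nq gf); apply: IHn => //; apply: leq_trans le_f.
by case: (fsize_reduct (ld b) f) => // eq_f; rewrite eq_f ltnn in lt_f.
Qed.

Lemma elapsed_sound t a Q h : a \in nodes N ->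
  (forall t' b g v, t' <= t -> b \in nodes N -> fsize g < fsize (Quant Q h) ->
     value t' b g = Some v -> truth_value N g v) ->
  elapsed t a (Quant Q h) -> answer_of (clock_state t a) (Quant Q h) = None ->
  (forall g, g \in children (clock_state t a) (Quant Q h) ->
     value t a g <> Some (evidence Q)) ->
  truth_value N (Quant Q h) (~~ evidence Q).
Proof.
move=> aN sound clock unanswered no_evidence rho /=.
apply/eqP/negPn/negP => neg.
have /quantb_evidence[b bN evidence_b] :
    quantb N Q (fun b => holds N (extend b rho) h) = evidence Q.
  by move: neg; case: (quantb _ _ _); case: (evidence Q).
have [t0 af le_t] := elapsed_asked clock.
have [tb le_tb [bf gf clock_g]] := reduct_elapsed_everywhere N_diameter aN bN af
  (nvars_consts_reduct_Quant (ld b) Q h) le_t.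
have le_tb_t : tb <= t := leq_trans (leq_addr _ _) le_tb.
have value_g : value tb b (reduct (ld b) (Quant Q h)) = Some (evidence Q).
  have := elapsed_value bN clock_g; case val: (value _ _ _) => [v|//] _.
  have := sound _ _ _ _ le_tb_t bN (fsize_reduct_Quant _ _ _) val rho.
  by rewrite holds_reduct_Quant evidence_b => ->.
have [lt_tb|ge_tb] := ltnP tb t.
  have ans_f := value_answered bf (evidence_value gf value_g).
  have := answered_everywhere N_diameter bN aN lt_tb le_tb ans_f.
  by rewrite unanswered.
have eq_t : tb = t by apply/anti_leq/andP.
have Delta0 : Delta = 0.
  by apply/eqP; rewrite -leqn0 -(leq_add2l tb) addn0 (leq_trans le_tb).
have eq_b : b = a := diameter0_eq N_diameter bN aN Delta0.
by rewrite eq_t eq_b in gf value_g; exact: no_evidence gf value_g.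
Qed.

Lemma value_sound t a f v :
  a \in nodes N -> value t a f = Some v -> truth_value N f v.
Proof.
elim/ltn_ind: t a f v => t IHt a f; have [n] := ubnP (fsize f).
elim: n a f => // n IHn a f; rewrite ltnS => le_f v aN.
have sound t' b g w : t' <= t -> b \in nodes N -> fsize g < fsize f ->
    value t' b g = Some w -> truth_value N g w.
  rewrite leq_eqVlt => /orP[/eqP->|lt_t] bN lt_g; last exact: IHt.
  by apply: IHn => //; exact: leq_trans le_f.
have sound_child g w : g \in children (clock_state t a) f ->
    value t a g = Some w -> truth_value N g w.
  by move/fsize_children; exact: sound.
case/valueP.
- case/answer_of_mem=> [->//|].
  case/(clock_state_answers_final aN) => t1 [b [lt_t bN]].
  case/(answers_origin bN) => t2 [c [le_t1 cN]].
  by apply: IHt => //; exact: leq_ltn_trans lt_t.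
- move=> g nq gf value_g rho; have := sound_child _ _ gf value_g rho.
  by have [_ ->] := child_reduct gf; rewrite holds_reduct.
- move=> Q h g eq_f -> gf value_g rho; have := sound_child _ _ gf value_g rho.
  have [_ ->] := child_reduct gf; rewrite eq_f holds_reduct_Quant => holds_h.
  by apply/quantb_evidence; exists a.
- move=> Q h eq_f -> unanswered clock no_evidence; subst f.
  exact: elapsed_sound clock unanswered no_evidence.
Qed.

Lemma answer_sound t a f v :
  a \in nodes N -> answer_of (final t a) f = Some v -> truth_value N f v.
Proof.
move=> aN /answer_of_mem[->//|/(answers_origin aN)[t' [b [_ bN]]]].
exact: value_sound.
Qed.

Lemma recorded_answered t0 a f q : a \in nodes N ->
  recorded (final t0 a) (Ask_bool f) (Some q) ->
  exists t v, [/\ recorded (final t a) (Ask_bool f) (Some q),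
    answer_of (final t a) f = Some v & truth_value N f v].
Proof.
move=> aN rf; pose t := t0 + 2 * Delta * nvars_consts f.
have rft : recorded (final t a) (Ask_bool f) (Some q).
  by apply: recorded_sub rf; apply: queries_final_le; rewrite leq_addr.
have := value_answered (recorded_asked rft)
  (elapsed_value aN (recorded_elapsed rf (leqnn t))).
case ans: (answer_of _ f) => [v|//] _; exists t, v; split=> //.
exact: answer_sound ans.
Qed.

Lemma request_asked : asked (final 0 r) initial_request.1 /\
  (initial_request.2 != None ->
   recorded (final 0 r) initial_request.1 initial_request.2).
Proof.
rewrite /asked /recorded queries_final.
by apply: (@requests_handled _ _ N Delta r l psi 0 r); rewrite /= eqxx mem_head.
Qed.

Definition is_answer s :=
  [/\ size s = l, {subset s <= nodes N} &
      forall rho, holds N (instantiate 0 s rho) psi].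

Lemma results_sound t a s :
  a \in nodes N -> s \in results (final t a) -> is_answer s.
Proof.
move=> aN; have new_sound t1 : s \in new_results (final t1 a) -> is_answer s.
  rewrite mem_pmap => /mapP[e /wf_queries[_ _]].
  case: (e_query e) => // f; case: (e_parent e) => // -[//|[|//] s' f'].
  case/(_ _ _ erefl) => -[<-] [eq_l sN _ holds_f]; case: eqP => // ans [->].
  by split=> // rho; rewrite -holds_f (answer_sound aN ans).
elim: t => [|t IHt]; rewrite results_final mem_undup mem_cat.
all: by rewrite results_clock_state => /orP[|/new_sound].
Qed.

Lemma instances_asked i s :
  0 < i -> i + size s = l -> {subset s <= nodes N} ->
  exists t f, forall a, a \in nodes N -> asked (final t a) (Ask_inst i s f).
Proof.
elim: s i => [|b s IHs] i i_gt0 eq_l sN.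
  exists Delta, initial_form => a aN; rewrite -[Delta]add0n.
  apply: (asked_everywhere N_diameter rN aN) => //.
  have [+ _] := request_asked; rewrite addn0 in eq_l.
  by rewrite /request -eq_l; case: i i_gt0 {eq_l}.
have bN : b \in nodes N by apply: sN; rewrite mem_head.
have [||x xs|t [f aq]] := IHs i.+1; rewrite ?addSnnS //.
  by apply: sN; rewrite inE xs orbT.
exists (t + Delta), (simp (ld b) (inst i b f)) => a aN.
apply: (asked_everywhere N_diameter bN aN) => //.
apply: recorded_asked; apply: (asked_processed (aq b bN)) => /=.
by case: i i_gt0 {eq_l aq}.
Qed.

Lemma tuple_recorded s : 0 < l -> size s = l -> {subset s <= nodes N} ->
  exists t f, exists2 a, a \in nodes N &
    recorded (final t a) (Ask_bool f) (Some (Ask_inst 0 s f)).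
Proof.
case: s => [|b s] l_gt0 eq_l sN; first by rewrite -eq_l in l_gt0.
have bN : b \in nodes N by apply: sN; rewrite mem_head.
have [|x xs|t [f aq]] := @instances_asked 1 s isT; first by rewrite -eq_l.
  by apply: sN; rewrite inE xs orbT.
exists t, (simp (ld b) (inst 0 b f)), b => //.
exact: (asked_processed (aq b bN)).
Qed.

Lemma producedP s : 0 < l -> produced N Delta r l psi s <-> is_answer s.
Proof.
move=> l_gt0; split=> [[t [a aN s_results]]|[eq_l sN holds_psi]].
  exact: results_sound s_results.
have [t0 [f [a aN rf]]] := tuple_recorded l_gt0 eq_l sN.
have [t [v [rft ans truth_f]]] := recorded_answered aN rf.
exists t, a => //; rewrite results_final mem_undup mem_cat; apply/orP; right.
rewrite mem_pmap; apply/mapP; case/recordedP: rft => t1 e_final.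
exists (Entry (Ask_bool f) (Some (Ask_inst 0 s f)) t1) => //=.
have [_ _ /(_ _ _ erefl)[_ [_ _ _ holds_f]]] := wf_queries e_final.
by rewrite ans -(truth_f (fun=> r)) holds_f holds_psi.
Qed.
End Correctness.

Section TupleSemantics.
Variables (U : choiceType) (D : nat) (N : network U D) (psi : form U).

Lemma sat_tupleP l (a : l.-tuple U) : free_below l psi ->
  sat_tuple N psi a <-> forall rho, holds N (instantiate 0 a rho) psi.
Proof.
move=> psi_free; split=> [sat_a rho|holds_a rho eq_a]; apply/holdsP.
  by apply: sat_a => i; rewrite /instantiate subn0 (tnth_nth (rho i)).
rewrite (eq_holds_below (rho' := instantiate 0 a rho) N psi_free) // => i lt_il.
by have := eq_a (Ordinal lt_il); rewrite (tnth_nth (rho i)) /instantiate subn0.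
Qed.

Lemma is_answer_tuple l (a : l.-tuple U) : free_below l psi ->
  is_answer N l psi a <-> {subset a <= nodes N} /\ sat_tuple N psi a.
Proof.
move=> psi_free; rewrite sat_tupleP //.
by split=> [[_ aN holds_a]|[aN holds_a]]; rewrite /is_answer ?size_tuple.
Qed.

Lemma models_sentence (A : {fset 0.-tuple U}) : free_below 0 psi ->
  models N psi A <-> truth_value N psi ([tuple] \in A).
Proof.
move=> psi_free.
have closed_psi rho rho' : holds N rho psi = holds N rho' psi.
  exact: eq_holds_below psi_free _.
have satP : sat_tuple N psi [tuple] <-> truth_value N psi true.
  rewrite sat_tupleP //.
  by split=> holds_psi rho; exact: etrans (closed_psi _ _) (holds_psi rho).
split=> [mA rho|truth_A a]; last first.
  rewrite tuple0; split=> [A0|[_ /satP truth_psi]].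
    by split=> //; apply/satP; rewrite -A0.
  have /fset0Pn[x _] := nodes_neq0 N.
  by rewrite -(truth_A (fun=> x)) truth_psi.
apply/idP/idP => [holds_psi|/mA[_ /satP truth_psi]]; last exact: truth_psi.
by apply/mA; split=> //; apply/satP => rho'; rewrite (closed_psi _ rho).
Qed.
End TupleSemantics.

Lemma computesP (U : choiceType) (D : nat) (N : network U D) (Delta : nat)
    (r : U) (psi : form U) (v : bool) :
  diameter_at_most N Delta -> r \in nodes N -> free_below 0 psi ->
  {subset ids psi <= nodes N} ->
  computes N Delta r psi v <-> truth_value N psi v.
Proof.
move=> N_diameter rN psi_free psi_ids; split=> [[t ans] rho|truth_psi].
  rewrite -(holds_request_form N Delta r).
  exact: (answer_sound N_diameter rN psi_free psi_ids rN ans rho).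
have [_ /(_ isT) recorded_psi] := request_asked N Delta r 0 psi.
have [t [w [_ ans truth_w]]] :=
  recorded_answered N_diameter rN psi_free psi_ids rN recorded_psi.
exists t; rewrite ans; congr Some.
by rewrite -(truth_w (fun=> r)) holds_request_form truth_psi.
Qed.

Theorem theorem2 (disp : Order.disp_t) (U : orderType disp)
    (U_infinite : forall s : seq U, exists u : U, u \notin s)
    (D : nat) (N : network U D) (Delta : nat)
    (N_diameter : diameter_at_most N Delta)
    (l : nat) (psi : form U)
    (psi_free : free_below l psi)
    (psi_ids : {subset ids psi <= nodes N})
    (A : {fset l.-tuple U}) :
  models N psi A <-> derives N Delta psi A.
Proof.
have /fset0Pn[r0 r0N] := nodes_neq0 N.
case: l psi_free A => [|l] psi_free A; rewrite /derives /=.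
  rewrite models_sentence //; split=> [truth_psi r rN|/(_ r0 r0N)[v]].
    exists ([tuple] \in A); first exact/computesP.
    by move=> a; rewrite tuple0.
  by move=> /computesP truth_psi ->; exact: truth_psi.
have produced_tuple r (a : l.+1.-tuple U) : r \in nodes N ->
    produced N Delta r l.+1 psi a <->
    {subset a <= nodes N} /\ sat_tuple N psi a.
  by move=> rN; rewrite producedP // is_answer_tuple.
split=> [mA r rN a|derA a]; first by rewrite produced_tuple.
by rewrite -(produced_tuple r0) //; exact: derA.
Qed.
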